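(* (1) There exists an absolute constant $c>0$ such that, for all integers $n\geq 2$ and $D\geq 3$, the number $\mathcal{N}(D,n)$ of rational numbers $z\in[n-1,n]$ of denominator at most $D$ such that $\Gamma(z)$ is also a rational number of denominator at most $D$ satisfies \[\mathcal{N}(D,n)\leq c\, n^4\log^3(n)\,\frac{\log^2(D)}{\log\log(D)}.\] (2) There exists an absolute constant $c'>0$ such that, for all integers $n\geq 2$ and $D\geq 3$, the number $\mathcal{N}'(D,n)$ of rational numbers $z\in[n-1,n]$ of denominator at most $D$ such that $1/\Gamma(z)$ is also a rational number of denominator at most $D$ satisfies \[\mathcal{N}'(D,n)\leq c'\, n^2\log^3(n)\,\frac{\log^2(D)}{\log\log(D)}.\]
   Context: $\Gamma$ is Euler's Gamma function. The denominator of a rational number is the positive denominator of its reduced form. $\log^k(x)$ means $(\log x)^k$, and $\log\log(D)=\log(\log D)$. An absolute constant is one depending on none of the parameters (here $n$ and $D$). *)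

(* Defs.v *)
From mathcomp Require Import all_boot all_order all_algebra.
From mathcomp Require Import finmap.
From mathcomp Require Import all_classical all_reals all_analysis.

Set Implicit Arguments.
Unset Strict Implicit.
Unset Printing Implicit Defensive.

Import Order.TTheory GRing.Theory Num.Theory.

Local Open Scope classical_set_scope.
Local Open Scope ring_scope.

(* Euler's integral. It is Gamma x only for 0 < x: elsewhere the integral
   diverges, and [Rintegral] returns the junk value 0. *)
Definition Gamma (R : realType) (x : R) : R :=
  \int[lebesgue_measure]_(t in `]0, +oo[) (t `^ (x - 1) * expR (- t)).

(* [denq] is the positive denominator of the reduced form. *)
Definition rational_points (R : realType) (f : R -> R) (D n : nat) : set rat :=
  [set z : rat | [/\ n%:R - 1 <= z <= n%:R, denq z <= D%:Z &
     exists2 w : rat, denq w <= D%:Z & f (ratr z) = ratr w]].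

(* [fset_set] is junk on infinite sets, hence the need for this lemma. *)
Lemma finite_rational_points (R : realType) (f : R -> R) (D n : nat) :
  (0 < n)%N -> finite_set (rational_points f D n).
Proof.
move=> n0.
pose g (p : 'I_(n * D).+1 * 'I_D.+1) : rat := p.1%:R / p.2%:R.
apply: (@sub_finite_set _ _ (g @` setT)); last exact/finite_image/finite_finset.
move=> z [/andP[zn zn'] zD _].
have z0 : 0 <= z by apply: le_trans zn; rewrite subr_ge0 ler1n.
have dE : (`|denq z|%N)%:Z = denq z by rewrite gez0_abs.
have nE : (`|numq z|%N)%:Z = numq z by rewrite gez0_abs// numq_ge0.
have lD : (`|denq z| < D.+1)%N by rewrite ltnS -lez_nat dE.
have lN : (`|numq z| < (n * D).+1)%N.
  rewrite ltnS -lez_nat nE -(ler_int rat) numqE PoszM intrM.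
  by apply: ler_pM => //; rewrite ?ler_int// ler0z.
exists (Ordinal lN, Ordinal lD) => //.
by rewrite /g /= -[_%:R]/((`|numq z|%N)%:Z%:~R) -[X in _ / X]/((`|denq z|%N)%:Z%:~R)
  nE dE divq_num_den.
Qed.

Definition num_rational_points (R : realType) (f : R -> R) (D n : nat) : nat :=
  #|` fset_set (rational_points f D n)|%fset.

(* Main.v *)
Require Import Defs.
From mathcomp Require Import all_boot all_order all_algebra.
From mathcomp Require Import finmap.
From mathcomp Require Import all_classical all_reals all_analysis.
From mathcomp Require Import perm measurable_realfun.
From mathcomp Require Import ring lra zify.

Set Implicit Arguments.
Unset Strict Implicit.
Unset Printing Implicit Defensive.

Import Order.TTheory GRing.Theory Num.Theory.
Import numFieldNormedType.Exports.

Local Open Scope classical_set_scope.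
Local Open Scope ring_scope.

(** Write f = 1 / Gamma and let z be a point of [n-1, n]. If Gamma(z) is rational
of denominator at most D, then f(z) is rational and its denominator is the
numerator of Gamma(z), hence at most D n^n, as Gamma(z) <= n^n. So both parts
count points z of denominator at most D such that f(z) has denominator at most
D n^n, and the bound of the second part, proved for all of these ([count_real]),
implies that of the first.

The function f is entire of order one: on the disc of radius r its modulus is at
most r^(C r). Fix r with r >= 2n and r^r >= D, let N = 80 r, and consider the N^2
monomials z^a f(z)^b with a, b < N. Two estimates are opposed.

- An interpolation determinant formed with these monomials at N^2 of the points
  is very small ([det_interp_le], [det_monoms_le]), since the points lie in an
  interval of length 1 and the functions are bounded on a disc of radius r. Its
  denominator is under control, so it vanishes ([int_det_ge1]).
- A nonzero polynomial P(z, f(z)) of degree less than N in each variable has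
  O(N^2 log N) zeros in [n-1, n] ([zero_estimate]). With more zeros, the
  Schwarz lemma makes P(z, f(z)) extremely small on a disc of radius O(N). But
  near a negative integer -k the function f is close to the linear function of
  slope (-1)^k k!, so that it takes there, at almost the same abscissa, N well
  separated values; letting k vary in an interval of length N one obtains a grid,
  and interpolation on it forces P = 0.

If there were more points than the second estimate allows, the matrix of all
monomials at all points would have full rank, and some determinant as in the
first one would not vanish ([count_bound]). Hence there are O(r^2 log r) points,
and r can be taken of size n log(D) / loglog(D) ([radius]).

Only real numbers occur. Truncating the exponentials in Gauss's product
exhibits f as a pointwise limit of polynomials, on both sides of 0
([approx_seq]). For a polynomial p the weighted norm, the sum of |p_i| r^i, plays
the part of the maximum modulus on the disc of radius r, and dividing
p - p(z) by X - z costs at most a factor r - |z| ([nrm_ddiv]); this replaces the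
Schwarz lemma and bounds the determinants. The approximants have norm at most
r^(15 r) ([nrm_approx]). Gauss's formula itself follows from Euler's integral by
the functional equation and the inequality of Wendel,
Gamma(y + s) <= y^s Gamma(y) for 0 <= s <= 1 ([Gamma_wendel]). *)

(** * Functional equation and Wendel's inequality for Euler's integral *)

Section GammaIntegral.
Variable R : realType.
Local Notation mu := (@lebesgue_measure R).
Implicit Types (x t s : R).

Let gamma_integrand x t : R := t `^ (x - 1) * expR (- t).
Let eGamma x : \bar R := (\int[mu]_(t in `]0%R, +oo[) (gamma_integrand x t)%:E)%E.

Lemma gamma_integrand_ge0 x t : 0 <= gamma_integrand x t.
Proof. by rewrite mulr_ge0 ?powR_ge0 ?expR_ge0. Qed.

Lemma cvg_expRN (t : R) : expR (- u) @[u --> t] --> expR (- t).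
Proof. by apply: continuous_comp; [exact: continuousN|exact: continuous_expR]. Qed.

Lemma continuous_powRl x t : 0 < t -> {for t, continuous (fun u : R => u `^ x)}.
Proof.
move=> t0; apply: differentiable_continuous; apply/derivable1_diffP.
by apply: derivable_powR; rewrite in_itv/= t0.
Qed.

Lemma gamma_integrand_continuous x t : 0 < t -> {for t, continuous (gamma_integrand x)}.
Proof.
move=> t0; apply: cvgM; first exact: continuous_powRl.
exact: cvg_expRN.
Qed.

Lemma measurable_gamma_integrand x (D : set R) :
  measurable D -> measurable_fun D (gamma_integrand x).
Proof.
move=> mD; apply: (@measurable_funS _ _ _ _ setT) => //.
apply: measurable_funM; first exact: measurable_powR.
by apply: measurableT_comp => //; exact: measurable_funN.
Qed.

(** Integration by parts on a compact interval, where nothing diverges; the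
boundary terms are moved so that both sides are sums of nonnegative terms and
pass to the limit in the extended reals. *)
Lemma gamma_integrand_parts x a b : 0 < x -> 0 < a -> a < b ->
  (\int[mu]_(t in `[a, b]) (gamma_integrand (x + 1) t)%:E + (b `^ x * expR (- b))%:E =
   x%:E * \int[mu]_(t in `[a, b]) (gamma_integrand x t)%:E + (a `^ x * expR (- a))%:E)%E.
Proof.
move=> x0 a0 ab.
have b0 : 0 < b by apply: lt_trans ab.
have pos t : a <= t -> 0 < t by apply: lt_le_trans.
have dE : (fun t : R => - expR (- t))^`()%classic = (fun t => expR (- t)).
  apply/funext => t; rewrite derive1N// derive1_comp//.
  rewrite derive1N// derive1_id derive1E.
  by have /funeqP -> := @derive_expR R; rewrite mulrN1 opprK.
have gfin y : (\int[mu]_(t in `[a, b]) (gamma_integrand y t)%:E)%E \is a fin_num.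
  apply: integrable_fin_num => //; apply: continuous_compact_integrable.
    exact: segment_compact.
  apply/subspace_continuousP => t /=; rewrite in_itv/= => /andP[/pos t0 _].
  by apply: cvg_within_filter; exact: gamma_integrand_continuous.
have := @integration_by_parts R (fun t => t `^ x) (fun t => - expR (- t))
  (fun t => x * t `^ (x - 1)) (fun t => expR (- t)) a b ab.
have -> : (\int[mu]_(t in `[a, b]) (t `^ x * expR (- t))%:E =
          \int[mu]_(t in `[a, b]) (gamma_integrand (x + 1) t)%:E)%E.
  by apply: eq_integral => t _; rewrite /gamma_integrand addrK.
have -> : (\int[mu]_(t in `[a, b]) (x * t `^ (x - 1) * - expR (- t))%:E =
          - x%:E * \int[mu]_(t in `[a, b]) (gamma_integrand x t)%:E)%E.
  rewrite -integralZl//; last first.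
    apply: continuous_compact_integrable; first exact: segment_compact.
    apply/subspace_continuousP => t /=; rewrite in_itv/= => /andP[/pos t0 _].
    by apply: cvg_within_filter; exact: gamma_integrand_continuous.
  by apply: eq_integral => t _; rewrite -EFinM /gamma_integrand mulrN mulNr mulrA.
move=> ->.
- by move: (gfin x) => /fineK <-; rewrite -EFinN -!EFinM -!EFinD; congr EFin; lra.
- apply/subspace_continuousP => t /=; rewrite in_itv/= => /andP[/pos t0 _].
  by apply: cvg_within_filter; apply: cvgMl_tmp; exact: continuous_powRl.
- split.
  + move=> t; rewrite in_itv/= => /andP[at_ _]; apply: derivable_powR.
    by rewrite in_itv/= andbT; apply: pos; exact: ltW.
  + exact/cvg_at_right_filter/continuous_powRl.
  + exact/cvg_at_left_filter/continuous_powRl.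
- move=> t; rewrite in_itv/= => /andP[/ltW/pos t0 _].
  by rewrite powR_derive1 // in_itv/= t0.
- apply/subspace_continuousP => t _; apply: cvg_within_filter; exact: cvg_expRN.
- split.
  + by move=> t _; exact: ex_derive.
  + by apply: cvg_at_right_filter; apply: cvgN; exact: cvg_expRN.
  + by apply: cvg_at_left_filter; apply: cvgN; exact: cvg_expRN.
- by move=> t _; rewrite dE.
Qed.

Lemma powR_expRN_bound x (N : nat) b : 0 <= x -> x <= N%:R -> 1 <= b ->
  b `^ x * expR (- b) <= N.+1`!%:R / b.
Proof.
move=> x0 xN b1; have b0 : 0 < b by lra.
rewrite expRN ler_pdivrMr ?expR_gt0// mulrAC ler_pdivlMr//.
have bx : b `^ x <= b ^+ N by rewrite -powR_mulrn ?(ltW b0)// ler_powR.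
have := expR_ge1Dxn N (ltW b0).
have f0 : (0 : R) < N.+1`!%:R by rewrite ltr0n fact_gt0.
move=> h; have {}h : b ^+ N.+1 / N.+1`!%:R <= expR b by lra.
move: h; rewrite ler_pdivrMr// => h.
by rewrite (le_trans (ler_wpM2r (ltW b0) bx))// -exprSr mulrC.
Qed.

Lemma cvg_powR_expRN x : 0 < x ->
  (j.+2%:R : R) `^ x * expR (- j.+2%:R) @[j --> \oo] --> (0 : R).
Proof.
move=> x0; pose N := (Num.truncn x).+1.
have xN : x <= N%:R by apply/ltW/truncnS_gt.
apply: (@squeeze_cvgr _ _ _ R (fun=> 0) (fun j : nat => N.+1`!%:R * j.+1%:R^-1)).
- near=> j; rewrite mulr_ge0 ?powR_ge0 ?expR_ge0//=.
  rewrite (le_trans (powR_expRN_bound (ltW x0) xN _)) ?ler1n//.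
  by rewrite ler_wpM2l// lef_pV2 ?posrE ?ltr0n// ler_nat.
- exact: cvg_cst.
- rewrite -[X in _ --> X](mulr0 N.+1`!%:R).
  by apply: cvgMl_tmp; exact: cvg_harmonic.
Unshelve. all: by end_near. Qed.

Lemma cvg_powR0_expRN x : 0 < x ->
  (j.+1%:R^-1 : R) `^ x * expR (- j.+1%:R^-1) @[j --> \oo] --> (0 : R).
Proof.
move=> x0.
have h : (j.+1%:R^-1 : R) `^ x @[j --> \oo] --> (0 : R).
  apply/cvgrPdist_lt => e e0.
  have := (@powR_cvg0 R x x0) => /cvgrPdist_lt/(_ e e0).
  case=> d /= d0 dP.
  have := (@cvg_harmonic R) => /cvgrPdist_lt/(_ d d0); apply: filterS => j /= jd.
  by apply: dP => //=; rewrite invr_gt0.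
apply: (@squeeze_cvgr _ _ _ R (fun=> 0) (fun j : nat => (j.+1%:R^-1 : R) `^ x)) => //.
  near=> j; rewrite mulr_ge0 ?powR_ge0 ?expR_ge0//=.
  by rewrite ler_piMr ?powR_ge0// expR_le1 oppr_le0.
exact: cvg_cst.
Unshelve. all: by end_near. Qed.

Lemma cvg_eGamma x :
  (\int[mu]_(t in `[(j.+1%:R^-1)%R, (j.+2%:R)%R]) (gamma_integrand x t)%:E)%E
    @[j --> \oo] --> eGamma x.
Proof.
have -> : eGamma x =
    (\int[mu]_(t in \bigcup_j `[(j.+1%:R^-1 : R)%R, (j.+2%:R)%R]%classic)
      (gamma_integrand x t)%:E)%E.
  congr (integral _ _ _); apply/seteqP; split => t /=.
  - rewrite in_itv/= andbT => t0.
    exists (maxn (Num.truncn t) (Num.truncn t^-1)) => //=; rewrite in_itv/=; apply/andP; split.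
      rewrite invf_ple ?posrE ?ltr0n// (le_trans (ltW (truncnS_gt _)))//.
      by rewrite ler_nat ltnS leq_maxr.
    rewrite (le_trans (ltW (truncnS_gt _)))// ler_nat ltnS leqW// leq_maxl//.
  - by case=> j _ /=; rewrite !in_itv/= andbT => /andP[+ _]; apply: lt_le_trans.
apply: ge0_nondecreasing_set_cvg_integral.
- apply/nondecreasing_seqP => j; apply/subsetPset => t /=; rewrite !in_itv/= => /andP[h1 h2].
  rewrite (le_trans h2) ?ler_nat// andbT; apply: le_trans h1.
  by rewrite lef_pV2 ?posrE ?ltr0n// ler_nat.
- by move=> i; exact: measurable_itv.
- by move=> i; apply/measurable_EFinP; apply: measurable_gamma_integrand.
- by move=> i t _; rewrite lee_fin gamma_integrand_ge0.
Qed.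

(** The functional equation in the extended reals: it holds before any
integral is known to be finite, and is what propagates finiteness from [1, 2]
to the whole half-line. *)
Lemma eGamma_rec x : 0 < x -> eGamma (x + 1) = (x%:E * eGamma x)%E.
Proof.
move=> x0.
pose a (j : nat) : R := j.+1%:R^-1. pose b (j : nat) : R := j.+2%:R.
have h1 : ((\int[mu]_(t in `[a j, b j]) (gamma_integrand (x + 1) t)%:E +
   (b j `^ x * expR (- b j))%:E)%E @[j --> \oo] --> (eGamma (x + 1) + 0)%E).
  apply: cvgeD => //; first by rewrite fin_num_adde_defl.
    exact: cvg_eGamma.
  by apply/cvg_EFin; [exact: nearW|exact: cvg_powR_expRN].
have h2 : ((x%:E * \int[mu]_(t in `[a j, b j]) (gamma_integrand x t)%:E +
   (a j `^ x * expR (- a j))%:E)%E @[j --> \oo] --> (x%:E * eGamma x + 0)%E).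
  apply: cvgeD => //; first by rewrite fin_num_adde_defl.
    by apply: cvgeZl => //; exact: cvg_eGamma.
  by apply/cvg_EFin; [exact: nearW|exact: cvg_powR0_expRN].
rewrite adde0 in h1; rewrite adde0 in h2.
apply: (cvg_unique (@ereal_hausdorff R) h1); rewrite (_ : (fun j => _) =
  (fun j => (x%:E * \int[mu]_(t in `[a j, b j]) (gamma_integrand x t)%:E +
   (a j `^ x * expR (- a j))%:E)%E)) //; apply/funext => j.
rewrite gamma_integrand_parts ?invr_gt0// /a /b (@le_lt_trans _ _ 1) ?ltr1n//.
by rewrite invf_le1 ?ltr0n// ler1n.
Qed.

Lemma eGamma1 : eGamma 1 = 1%E.
Proof.
have mE : measurable_fun (`]0%R, +oo[ : set R) (fun t : R => (expR (- t))%:E).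
  by apply/measurable_EFinP; apply: measurableT_comp => //; exact: measurable_funN.
transitivity (\int[mu]_(t in `[0%R, +oo[) (expR (- t))%:E)%E.
  rewrite -integral_itv_obnd_cbnd//; apply: eq_integral => t _.
  by rewrite /gamma_integrand subrr powRr0 mul1r.
rewrite (@ge0_continuous_FTC2y R _ (fun t => - expR (- t)) 0 0).
- by rewrite oppr0 expR0 EFinN oppeK add0e.
- by move=> t _; exact: expR_ge0.
- by apply/subspace_continuousP => t _; apply: cvg_within_filter; exact: cvg_expRN.
- by rewrite -[X in _ --> X]oppr0; apply: cvgN; exact: cvgr_expR.
- by move=> t _; exact: ex_derive.
- by apply: cvg_at_right_filter; apply: cvgN; exact: cvg_expRN.
- move=> t _; rewrite derive1N// derive1_comp//.
  rewrite derive1N// derive1_id derive1E.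
  by have /funeqP -> := @derive_expR R; rewrite mulrN1 opprK.
Qed.

Lemma expR_convex s a : 0 <= s <= 1 -> expR (s * a) <= (1 - s) + s * expR a.
Proof.
move=> /andP[s0 s1].
have h1 : expR (s * a) * (1 + (1 - s) * a) <= expR a.
  have -> : expR a = expR (s * a) * expR ((1 - s) * a).
    by rewrite -expRD; congr expR; ring.
  by rewrite ler_wpM2l ?expR_ge0// expR_ge1Dx.
have h2 : expR (s * a) * (1 + - (s * a)) <= 1.
  rewrite -[leRHS](expRxMexpNx_1 (s * a)).
  by rewrite ler_wpM2l ?expR_ge0// expR_ge1Dx.
set e := expR (s * a) in h1 h2 *.
by nra.
Qed.

(** The concave function [t `^ s] lies below its tangent at [y]. *)
Lemma powR_tangent s y t : 0 <= s <= 1 -> 0 < y -> 0 < t ->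
  t `^ s <= y `^ s * (1 - s) + y `^ s * s / y * t.
Proof.
move=> s01 y0 t0.
have := expR_convex (ln t - ln y) s01.
rewrite mulrBr expRB expRB !lnK ?posrE//.
have e u : 0 < u -> expR (s * ln u) = u `^ s.
  by move=> u0; rewrite /powR gt_eqF.
rewrite !e// ler_pdivrMr ?powR_gt0// => h; apply: le_trans h _.
by rewrite le_eqVlt; apply/orP; left; apply/eqP; ring.
Qed.

Lemma eGamma_ge0 x : (0 <= eGamma x)%E.
Proof. by apply: integral_ge0 => t _; rewrite lee_fin gamma_integrand_ge0. Qed.

(** Integrate the tangent inequality at [y] against the integrand of
[Gamma y]: the linear term contributes [Gamma (y + 1) = y * Gamma y], so that
the bound collapses to [y `^ s * Gamma y]. *)
Lemma eGamma_wendel s y : 0 <= s <= 1 -> 0 < y ->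
  (eGamma (y + s) <= (y `^ s)%:E * eGamma y)%E.
Proof.
move=> s01 y0; have /andP[s0 s1] := s01.
have mg x : measurable_fun (`]0%R, +oo[ : set R) (fun t => (gamma_integrand x t)%:E).
  by apply/measurable_EFinP; apply: measurable_gamma_integrand; exact: measurable_itv.
pose c := y `^ s * (1 - s); pose d := y `^ s * s / y.
have c0 : 0 <= c by rewrite mulr_ge0 ?powR_ge0//; lra.
have d0 : 0 <= d by rewrite !mulr_ge0 ?powR_ge0 ?invr_ge0// ltW.
have gE x e t : 0 <= e -> `]0%R, +oo[%classic t -> (0 <= e%:E * (gamma_integrand x t)%:E)%E.
  by move=> e0 _; rewrite -EFinM lee_fin mulr_ge0// gamma_integrand_ge0.
have : (eGamma (y + s) <= c%:E * eGamma y + d%:E * eGamma (y + 1))%E.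
  have g0 u t : `]0%R, +oo[%classic t -> (0 <= (gamma_integrand u t)%:E)%E.
    by move=> _; rewrite lee_fin gamma_integrand_ge0.
  have eZ k u : 0 <= k ->
      (k%:E * eGamma u = \int[mu]_(t in `]0%R, +oo[) (k%:E * (gamma_integrand u t)%:E))%E.
    by move=> k0; rewrite ge0_integralZl//; [exact: mg|exact: g0].
  rewrite !eZ//.
  have mZ k u : measurable_fun (`]0%R, +oo[ : set R) (fun t => (k%:E * (gamma_integrand u t)%:E)%E).
    by apply: measurable_funeM; exact: mg.
  rewrite -ge0_integralD//; try exact: mZ; try by move=> t; exact: gE.
  apply: ge0_le_integral => //.
  - by move=> t _; rewrite lee_fin gamma_integrand_ge0.
  - exact: mg.
  - by apply: emeasurable_funD; exact: mZ.
  - move=> t /=; rewrite in_itv/= andbT => t0.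
    rewrite -!EFinM -EFinD lee_fin /gamma_integrand.
    have -> : y + s - 1 = s + (y - 1) by ring.
    rewrite powRD; last by rewrite (gt_eqF t0) implybT.
    have -> : t `^ (y + 1 - 1) = t * t `^ (y - 1).
      by rewrite mulr_powRB1 ?(ltW t0)// addrK.
    have := powR_tangent s01 y0 t0; rewrite -/c -/d => h.
    rewrite (le_trans (ler_wpM2r (expR_ge0 _) (ler_wpM2r (powR_ge0 _ _) h)))//.
    by rewrite le_eqVlt; apply/orP; left; apply/eqP; ring.
move=> h; apply: le_trans h _; rewrite eGamma_rec// muleA -EFinM.
rewrite -ge0_muleDl ?lee_fin//; last by rewrite mulr_ge0// ltW.
rewrite -EFinD lee_wpmul2r ?eGamma_ge0// lee_fin /c /d divfK ?gt_eqF//.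
by rewrite -mulrDr subrK mulr1.
Qed.

Lemma eGamma_fin x : 0 < x -> eGamma x \is a fin_num.
Proof.
have fin1 s : 0 <= s <= 1 -> eGamma (1 + s) \is a fin_num.
  move=> s01; have := eGamma_wendel s01 ltr01.
  rewrite eGamma1 mule1 powR1 => h; rewrite ge0_fin_numE ?eGamma_ge0//.
  exact: le_lt_trans h (ltry _).
have main n y : 0 < y <= n.+1%:R -> eGamma y \is a fin_num.
  elim: n y => [|n IH] y /andP[y0 yn].
    have := @fin1 y; rewrite (ltW y0) yn => /(_ isT).
    rewrite addrC eGamma_rec//.
    move: (eGamma_ge0 y); case: (eGamma y) => [r||] //= _.
    by rewrite mulry gtr0_sg// mul1e.
  have [y1|y1] := leP y n.+1%:R; first by apply: IH; rewrite y0.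
  have y2 : 1 < y by apply: le_lt_trans y1; rewrite ler1n.
  rewrite -(subrK 1 y) eGamma_rec ?subr_gt0// fin_numM// IH// subr_gt0 y2/=.
  by rewrite lerBlDr -natr1 in yn *; move: yn; rewrite -natr1.
move=> x0; apply: (main (Num.truncn x)); rewrite x0/=.
exact/ltW/truncnS_gt.
Qed.

Let GammaE x : 0 < x -> (Gamma x)%:E = eGamma x.
Proof. by move=> x0; rewrite /Gamma /Rintegral fineK// eGamma_fin. Qed.

Lemma GammaD1 x : 0 < x -> Gamma (x + 1) = x * Gamma x.
Proof.
move=> x0; apply: EFin_inj.
have x1 : 0 < x + 1 by rewrite addr_gt0.
by rewrite (GammaE x1) (EFinM x (Gamma x)) (GammaE x0); exact: eGamma_rec.
Qed.

Lemma Gamma1 : Gamma (1 : R) = 1.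
Proof. by apply: EFin_inj; rewrite GammaE// eGamma1. Qed.

Lemma Gamma_wendel s y : 0 <= s <= 1 -> 0 < y ->
  Gamma (y + s) <= y `^ s * Gamma y.
Proof.
move=> s01 y0; have /andP[s0 s1] := s01.
have ys0 : 0 < y + s by rewrite ltr_pwDl.
have := eGamma_wendel s01 y0; rewrite -(GammaE y0) -(GammaE ys0) -EFinM.
by rewrite lee_fin.
Qed.

Lemma Gamma_ge0 x : 0 <= Gamma x.
Proof. by apply: Rintegral_ge0 => t _; exact: gamma_integrand_ge0. Qed.

(** Wendel's inequality read from [1 + s] up to [2] gives positivity on
[1, 2], and the functional equation carries it elsewhere. *)
Lemma Gamma_gt0 x : 0 < x -> 0 < Gamma x.
Proof.
have h1 s : 0 <= s <= 1 -> 0 < Gamma (1 + s).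
  move=> /andP[s0 s1]; rewrite lt_neqAle Gamma_ge0 andbT eq_sym; apply/eqP => h.
  have s1' : 0 <= 1 - s <= 1 by lra.
  have s2 : 0 < 1 + s by lra.
  have := Gamma_wendel s1' s2; rewrite h mulr0.
  have -> : 1 + s + (1 - s) = 1 + 1 :> R by ring.
  by rewrite GammaD1// Gamma1 mul1r ler10.
have main n (y : R) : 0 < y <= n.+1%:R -> 0 < Gamma y.
  elim: n y => [|n IH] y /andP[y0 yn].
    have := @h1 y; rewrite (ltW y0) yn => /(_ isT).
    by rewrite addrC GammaD1// pmulr_rgt0.
  have [y1|y1] := leP y n.+1%:R; first by apply: IH; rewrite y0.
  have y2 : 1 < y by apply: le_lt_trans y1; rewrite ler1n.
  rewrite -(subrK 1 y) GammaD1 ?subr_gt0// mulr_gt0 ?subr_gt0// IH// subr_gt0 y2/=.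
  by move: yn; rewrite lerBlDr -natr1.
move=> x0; apply: (main (Num.truncn x)); rewrite x0/=.
exact/ltW/truncnS_gt.
Qed.
End GammaIntegral.

(** * Gauss's product formula *)

Section GaussLimit.
Variable R : realType.
Implicit Types (x t : R) (m k : nat).

(** The reciprocal of the [m]-th term of Gauss's limit for [Gamma x]; it is
an entire function of [x], and makes sense at every real. *)
Definition gaussf m x : R :=
  \prod_(k < m.+1) (x + k%:R) / m`!%:R * m.+1%:R `^ (- x).

Lemma Gamma_rising m x : 0 < x ->
  Gamma (x + m%:R) = Gamma x * \prod_(k < m) (x + k%:R).
Proof.
move=> x0; elim: m => [|m IH]; first by rewrite big_ord0 mulr1 addr0.
rewrite -natr1 addrA GammaD1 ?IH; last by rewrite ltr_pwDl.
by rewrite big_ord_recr/= [RHS]mulrA [RHS]mulrC.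
Qed.

Lemma Gamma_natS m : Gamma (m.+1%:R : R) = m`!%:R.
Proof.
elim: m => [|m IH]; first by rewrite Gamma1.
by rewrite -natr1 GammaD1// IH factS natrM.
Qed.

Lemma gaussfE m x : 0 < x ->
  gaussf m x = Gamma (m.+1%:R + x) / (m`!%:R * m.+1%:R `^ x) / Gamma x.
Proof.
move=> x0; rewrite addrC Gamma_rising// /gaussf powRN invfM.
have := Gamma_gt0 x0; set G := Gamma x => G0.
by field; rewrite !gt_eqF ?powR_gt0// ltr0n fact_gt0.
Qed.

(** Both bounds are Wendel's inequality, applied at [m + 1] with exponent [x]
and at [m + 1 + x] with exponent [1 - x]. *)
Lemma gaussf_bounds m x : 0 < x <= 1 ->
  m.+1%:R / (m.+1%:R + x) / Gamma x <= gaussf m x <= (Gamma x)^-1.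
Proof.
move=> /andP[x0 x1]; have G0 := Gamma_gt0 x0; rewrite gaussfE//.
set M : R := m.+1%:R; have M0 : 0 < M by rewrite ltr0n.
have F0 : 0 < m`!%:R :> R by rewrite ltr0n fact_gt0.
have Mx0 : 0 < M `^ x by rewrite powR_gt0.
apply/andP; split; last first.
  rewrite ler_piMl ?invr_ge0 ?(ltW G0)// ler_pdivrMr ?mulr_gt0// mul1r.
  have : 0 <= x <= 1 by rewrite (ltW x0).
  by move=> /Gamma_wendel/(_ M0); rewrite {2}/M Gamma_natS mulrC.
rewrite ler_pM2r ?invr_gt0//.
have s1 : 0 <= 1 - x <= 1 by lra.
have Mx : 0 < M + x by lra.
have := Gamma_wendel s1 Mx.
have -> : M + x + (1 - x) = M + 1 by ring.
rewrite GammaD1// {2}/M Gamma_natS => h.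
rewrite ler_pdivrMr// mulrAC ler_pdivlMr ?mulr_gt0//.
have h2 : M `^ x <= (M + x) `^ x.
  by rewrite ge0_ler_powR ?nnegrE ?(ltW x0)// ?(ltW M0) ?(ltW Mx)// lerDl ltW.
have h3 : (M + x) `^ (1 - x) * (M + x) `^ x = M + x.
  by rewrite -powRD ?subrK ?powRr1 ?(ltW Mx)// (gt_eqF Mx) implybT.
rewrite mulrA; apply: (le_trans (ler_wpM2r (ltW Mx0) h)).
rewrite mulrAC mulrC ler_wpM2l ?(ltW (Gamma_gt0 Mx))//.
by rewrite -[leRHS]h3 ler_wpM2l ?powR_ge0.
Qed.

Lemma cvg_divS x : x / m.+1%:R @[m --> \oo] --> (0 : R).
Proof.
rewrite -[X in _ --> X](mulr0 x); apply: cvgMl_tmp; exact: cvg_harmonic.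
Qed.

Lemma cvg_1DdivS x : 1 + x / m.+1%:R @[m --> \oo] --> (1 : R).
Proof.
rewrite -[X in _ --> X]addr0; apply: cvgD; first exact: cvg_cst.
exact: cvg_divS.
Qed.

Lemma gaussfD1 m x :
  x * gaussf m (x + 1) = gaussf m x * (1 + x / m.+1%:R).
Proof.
rewrite /gaussf [in RHS]big_ord_recl [in LHS]big_ord_recr/= addr0.
rewrite [in LHS](eq_bigr (fun i : 'I_m => x + (lift ord0 i)%:R)); last first.
  by move=> i _; rewrite lift0 -natr1 -addrA (addrC 1).
rewrite opprD powRD ?powR_inv1; last 2 first.
- by rewrite ?ler0n ?pnatr_eq0 ?implybT.
- by rewrite ?ler0n ?pnatr_eq0 ?implybT.
have f0 : m`!%:R != 0 :> R by rewrite pnatr_eq0 -lt0n fact_gt0.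
have n0 : m%:R + 1 != 0 :> R by rewrite natr1 pnatr_eq0.
by rewrite -natr1; field; rewrite f0 n0.
Qed.

Lemma gaussf_cvg01 x : 0 < x <= 1 -> gaussf m x @[m --> \oo] --> (Gamma x)^-1.
Proof.
move=> x01; have /andP[x0 x1] := x01.
apply: (@squeeze_cvgr _ _ _ R (fun m => (1 + x / m.+1%:R)^-1 / Gamma x) (fun=> (Gamma x)^-1)).
- apply: nearW => m; have := gaussf_bounds m x01.
  have -> : m.+1%:R / (m.+1%:R + x) = (1 + x / m.+1%:R)^-1 :> R.
    have n0 : (0 : R) < m.+1%:R by rewrite ltr0n.
    by field; rewrite !gt_eqF//; lra.
  by [].
- rewrite -[X in _ --> X]mul1r; apply: cvgMr_tmp.
  rewrite -[X in _ --> X]invr1; apply: cvgV => //; exact: cvg_1DdivS.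
- exact: cvg_cst.
Qed.

Lemma gaussf_cvgS x (l : R) : x != 0 -> gaussf m x @[m --> \oo] --> l ->
  gaussf m (x + 1) @[m --> \oo] --> l / x.
Proof.
move=> x0 h; rewrite (_ : (fun m => _) = (fun m => gaussf m x * (1 + x / m.+1%:R) / x)).
  apply: cvgMr_tmp; rewrite -[X in _ --> X]mulr1.
  by apply: cvgM => //; exact: cvg_1DdivS.
by apply/funext => m; rewrite -gaussfD1 mulrAC mulfV// mul1r.
Qed.

Lemma gaussf_cvgP x (l : R) : gaussf m (x + 1) @[m --> \oo] --> l ->
  gaussf m x @[m --> \oo] --> x * l.
Proof.
move=> h.
have : (x * gaussf m (x + 1)) / (1 + x / m.+1%:R) @[m --> \oo] --> x * l / 1.
  apply: cvgM; first exact: cvgMl_tmp.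
  by apply: cvgV => //; exact: cvg_1DdivS.
rewrite divr1; apply: cvg_trans; apply: near_eq_cvg.
near=> m; rewrite gaussfD1 mulfK//.
have : `|x / m.+1%:R| < 1.
  near: m; have /cvgrPdist_lt/(_ 1 ltr01) := @cvg_divS x.
  by apply: filterS => m; rewrite sub0r normrN.
rewrite ltr_norml => /andP[h1 _]; rewrite gt_eqF//.
by move: h1; rewrite -subr_gt0 opprK addrC.
Unshelve. all: by end_near. Qed.

(** The functional equation, shared by Gauss's terms in the limit, reduces the
statement to [0 < x <= 1], where the two bounds squeeze. *)
Lemma gaussf_cvg x : 0 < x -> gaussf m x @[m --> \oo] --> (Gamma x)^-1.
Proof.
have main n y : 0 < y <= n.+1%:R -> gaussf m y @[m --> \oo] --> (Gamma y)^-1.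
  elim: n y => [|n IH] y /andP[y0 yn]; first by apply: gaussf_cvg01; rewrite y0.
  have [y1|y1] := leP y n.+1%:R; first by apply: IH; rewrite y0.
  have y2 : 1 < y by apply: le_lt_trans y1; rewrite ler1n.
  rewrite -(subrK 1 y) GammaD1 ?subr_gt0// invfM mulrC.
  apply: gaussf_cvgS; first by rewrite gt_eqF// subr_gt0.
  by apply: IH; rewrite subr_gt0 y2/=; move: yn; rewrite lerBlDr -natr1.
move=> x0; apply: (main (Num.truncn x)); rewrite x0/=.
exact/ltW/truncnS_gt.
Qed.

(** The limit defines the continuation of [1 / Gamma] to the left of [0],
with the value that the functional equation dictates. *)
Lemma gaussf_cvgB t k : 0 < t -> gaussf m (t - k%:R) @[m --> \oo] -->
  (\prod_(j < k) (t - j.+1%:R)) / Gamma t.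
Proof.
move=> t0; elim: k => [|k IH].
  by rewrite subr0 big_ord0 mul1r; exact: gaussf_cvg.
rewrite big_ord_recr/= mulrAC mulrC; apply: gaussf_cvgP.
by rewrite -natr1 opprD addrA subrK.
Qed.

Lemma Gamma_1_2 s : 0 <= s <= 1 -> Gamma (1 + s : R) <= 1.
Proof.
by move=> s01; have := Gamma_wendel s01 ltr01; rewrite powR1 Gamma1 mulr1.
Qed.

(** [1 / Gamma] is [t] up to a relative error [t]: both sides are Wendel's
inequality between [1] and [2], divided by [t]. *)
Lemma invGamma_near0 t : 0 < t <= 1 -> t <= (Gamma t)^-1 <= t * (1 + t).
Proof.
move=> /andP[t0 t1]; have G0 := Gamma_gt0 t0.
have s1 : 0 <= 1 - t <= 1 by lra.
have t01 : 0 <= t <= 1 by lra.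
have t2 : 0 < 1 + t by lra.
have := Gamma_1_2 t01; have := Gamma_wendel s1 t2.
have -> : 1 + t + (1 - t) = 1 + 1 by ring.
rewrite GammaD1// Gamma1 mul1r (addrC 1 t) GammaD1// => h1 h2.
apply/andP; split.
  by rewrite -[leRHS]mul1r ler_pdivlMr.
rewrite -[leLHS]mul1r ler_pdivrMr//; apply: (le_trans h1).
rewrite (_ : t * (t + 1) * Gamma t = (t + 1) * (t * Gamma t)); last by ring.
rewrite ler_wpM2r ?mulr_ge0 ?(ltW t0) ?(ltW G0)// ler1_powR //; lra.
Qed.

Lemma Gamma_le_expn n x : (2 <= n)%N -> 1 <= x <= n%:R -> Gamma x <= n%:R ^+ n.
Proof.
elim: n x => // n IH x; rewrite leq_eqVlt => /predU1P[[<-]|n2] /andP[x1 xn].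
  have := @Gamma_1_2 (x - 1); rewrite (addrC 1) subrK => /(_ _)/le_trans; apply.
    by rewrite subr_ge0 x1/= lerBlDr.
  by rewrite exprn_ege1// ler1n.
have nS : n%:R ^+ n <= n.+1%:R ^+ n.+1 :> R.
  rewrite exprS (@le_trans _ _ (n.+1%:R ^+ n))//.
    by rewrite lerXn2r ?nnegrE// ler_nat.
  by rewrite ler_peMl ?exprn_ge0// ler1n.
have [xn'|xn'] := leP x n%:R; first by apply: le_trans nS; apply: IH; rewrite ?x1.
have n2' : (2 : R) <= n%:R by rewrite ler_nat.
rewrite -(subrK 1 x) GammaD1; last by lra.
have xb : x - 1 <= n%:R by rewrite lerBlDr natr1.
apply: (@le_trans _ _ (n%:R * n%:R ^+ n)).
  apply: ler_pM => //; [lra|exact: Gamma_ge0|].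
  by apply: IH => //; rewrite xb andbT; lra.
rewrite -exprS lerXn2r ?nnegrE// ler_nat//.
Qed.
End GaussLimit.

(** * Weighted norms and divided differences of polynomials *)

Section PolyNorm.
Variable R : realType.
Implicit Types (p q : {poly R}) (r x z w : R) (s : seq R).

(** It dominates the modulus of [p] on the complex disc of radius [r], is
submultiplicative, and takes the place of the maximum modulus throughout. *)
Definition nrm r p : R := \sum_(i < size p) `|p`_i| * r ^+ i.

Lemma nrmE n r p : (size p <= n)%N -> nrm r p = \sum_(i < n) `|p`_i| * r ^+ i.
Proof.
move=> pn; rewrite /nrm (big_ord_widen n (fun i : nat => `|p`_i| * r ^+ i) pn).
rewrite big_mkcond; apply: eq_bigr => i _; case: ltnP => // h.
by rewrite nth_default// normr0 mul0r.
Qed.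

Lemma nrm0 r : nrm r 0 = 0.
Proof. by rewrite /nrm size_poly0 big_ord0. Qed.

Lemma nrm_ge0 r p : 0 <= r -> 0 <= nrm r p.
Proof. by move=> r0; apply: sumr_ge0 => i _; rewrite mulr_ge0// exprn_ge0. Qed.

Lemma nrmC r c : nrm r c%:P = `|c|.
Proof.
by rewrite (@nrmE 1) ?size_polyC_leq1// big_ord1 coefC eqxx expr0 mulr1.
Qed.

Lemma nrm_MXaddC r q c : nrm r (q * 'X + c%:P) = r * nrm r q + `|c|.
Proof.
rewrite (@nrmE (size q).+1); last first.
  by rewrite size_MXaddC; case: ifP.
rewrite big_ord_recl coefD coefMX coefC eqxx add0r expr0 mulr1 addrC; congr (_ + _).
rewrite /nrm mulr_sumr; apply: eq_bigr => i _.
by rewrite lift0 coefD coefMX coefC/= addr0 exprS mulrCA.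
Qed.

Lemma nrmMX r q : nrm r (q * 'X) = r * nrm r q.
Proof. by have := nrm_MXaddC r q 0; rewrite polyC0 normr0 !addr0. Qed.

Lemma nrmMXn r q n : nrm r (q * 'X^n) = r ^+ n * nrm r q.
Proof.
elim: n => [|n IH]; first by rewrite !expr0 mulr1 mul1r.
by rewrite exprSr mulrA nrmMX IH exprS mulrA.
Qed.

Lemma nrmXn r n : nrm r 'X^n = r ^+ n.
Proof. by rewrite -[X in nrm r X]mul1r nrmMXn nrmC normr1 mulr1. Qed.

Lemma nrmZ r c q : nrm r (c *: q) = `|c| * nrm r q.
Proof.
rewrite (@nrmE (size q)) ?size_scale_leq// /nrm mulr_sumr.
by apply: eq_bigr => i _; rewrite coefZ normrM mulrA.
Qed.

Lemma nrmD r p q : 0 <= r -> nrm r (p + q) <= nrm r p + nrm r q.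
Proof.
move=> r0; pose n := maxn (size p) (size q).
rewrite (@nrmE n) ?size_polyD// (@nrmE n _ p) ?leq_maxl// (@nrmE n _ q) ?leq_maxr//.
rewrite -big_split/=; apply: ler_sum => i _.
by rewrite coefD -mulrDl ler_wpM2r ?exprn_ge0// ler_normD.
Qed.

Lemma nrm_sum r I (t : seq I) (P : pred I) (F : I -> {poly R}) : 0 <= r ->
  nrm r (\sum_(i <- t | P i) F i) <= \sum_(i <- t | P i) nrm r (F i).
Proof.
move=> r0; apply: (big_ind2 (fun p (a : R) => nrm r p <= a)) => //.
- by rewrite nrm0.
- by move=> p a q b pa qb; apply: (le_trans (nrmD _ _ r0)); exact: lerD.
Qed.

Lemma nrmM r p q : 0 <= r -> nrm r (p * q) <= nrm r p * nrm r q.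
Proof.
move=> r0; rewrite -{1}[p]coefK poly_def mulr_suml.
apply: (le_trans (nrm_sum _ _ _ r0)); rewrite [in leRHS]/nrm mulr_suml.
apply: ler_sum => i _.
by rewrite -scalerAl nrmZ [_ * q]mulrC nrmMXn mulrA.
Qed.

Lemma nrmX r p n : 0 <= r -> nrm r (p ^+ n) <= nrm r p ^+ n.
Proof.
move=> r0; elim: n => [|n IH]; first by rewrite !expr0 -polyC1 nrmC normr1.
rewrite !exprS; apply: (le_trans (nrmM _ _ r0)).
by apply: ler_pM => //; exact: nrm_ge0.
Qed.

Lemma horner_nrm r p x : `|x| <= r -> `|p.[x]| <= nrm r p.
Proof.
move=> xr; rewrite horner_coef; apply: (le_trans (ler_norm_sum _ _ _)).
apply: ler_sum => i _; rewrite normrM normrX ler_wpM2l//.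
by rewrite lerXn2r ?nnegrE// (le_trans _ xr).
Qed.

Lemma nrm_coef p i : `|p`_i| <= nrm 1 p.
Proof.
have [pi|pi] := leqP (size p) i.
  by rewrite nth_default// normr0 nrm_ge0.
rewrite /nrm (bigD1 (Ordinal pi))//= expr1n mulr1 lerDl.
by apply: sumr_ge0 => j _; rewrite mulr_ge0// exprn_ge0.
Qed.

(** Its value at [x] is the divided difference of [p] at [z] and [x]. *)
Definition ddiv z p : {poly R} := (p - p.[z]%:P) %/ ('X - z%:P).

Lemma ddivP z p : p = p.[z]%:P + ddiv z p * ('X - z%:P).
Proof.
rewrite /ddiv divpK; first by rewrite addrC subrK.
by rewrite dvdp_XsubCl rootE !hornerE subrr.
Qed.

Lemma ddivE z p x : p.[x] = p.[z] + (x - z) * (ddiv z p).[x].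
Proof. by rewrite {1}(ddivP z p) !hornerE mulrC. Qed.

Lemma ddiv_unique z p q c : p = c%:P + q * ('X - z%:P) -> ddiv z p = q.
Proof.
move=> pE; have cE : p.[z] = c by rewrite pE !hornerE subrr mulr0 addr0.
by rewrite /ddiv cE pE addrC addKr mulpK// polyXsubC_eq0.
Qed.

Lemma ddiv_MXaddC z q c : ddiv z (q * 'X + c%:P) = ddiv z q * 'X + q.[z]%:P.
Proof.
apply: (@ddiv_unique _ _ _ (q.[z] * z + c)).
rewrite {1}(ddivP z q) polyCD polyCM.
by ring.
Qed.

(** The algebraic form of the Schwarz lemma: dividing out a zero at [z] costs
a factor [r - |z|] at most. The extra summand [nrm `|z| p] is what makes the
induction on [p] (Horner's scheme) go through. *)
Lemma nrm_ddiv r z p : `|z| <= r ->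
  (r - `|z|) * nrm r (ddiv z p) + nrm `|z| p <= nrm r p.
Proof.
move=> zr; elim/poly_ind: p => [|q c IH].
  by rewrite (@ddiv_unique _ _ 0 0) ?mul0r ?addr0// !nrm0 mulr0 addr0.
rewrite ddiv_MXaddC !nrm_MXaddC.
have h : `|q.[z]| <= nrm `|z| q by apply: horner_nrm.
have r0 : 0 <= r by apply: le_trans zr.
have := ler_wpM2l r0 IH.
have : 0 <= (r - `|z|) * (nrm `|z| q - `|q.[z]|) by rewrite mulr_ge0// subr_ge0.
set a := nrm _ _; set b := nrm _ _; set d := nrm _ _; set y := `|q.[z]|.
set u := `|z|; set v := `|c|; nra.
Qed.

Lemma nrm_ddiv_le r n0 z p : `|z| <= n0 -> n0 < r ->
  nrm r (ddiv z p) <= nrm r p / (r - n0).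
Proof.
move=> zn nr; have zr : `|z| < r by apply: le_lt_trans nr.
have r0 : 0 <= r by apply: le_trans (ltW zr).
rewrite ler_pdivlMr ?subr_gt0//.
apply: (@le_trans _ _ ((r - `|z|) * nrm r (ddiv z p))).
  by rewrite mulrC ler_wpM2r ?nrm_ge0// lerB.
have := nrm_ddiv p (ltW zr); apply: le_trans.
by rewrite lerDl nrm_ge0.
Qed.

Lemma size_ddiv n z p : (size p <= n.+1)%N -> (size (ddiv z p) <= n)%N.
Proof.
move=> pn; rewrite /ddiv size_divp ?polyXsubC_eq0// size_XsubC/=.
rewrite leq_subLR add1n (leq_trans (size_polyD _ _))// geq_max pn size_polyN.
by rewrite (leq_trans (size_polyC_leq1 _)).
Qed.

(** Divide by [X - z] at each [z] of [s] in turn. The polynomials need only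
vanish on [s] in the limit: for [x] different from [z] the value at [x] of a
divided difference is a combination of values, hence has a limit too. *)
Lemma cvg_zeros_bound r n0 A s (q : nat -> {poly R}) w v :
  uniq s -> w \notin s -> {in s, forall x, `|x| <= n0} -> n0 < r -> `|w| <= r ->
  (forall j, nrm r (q j) <= A) ->
  {in s, forall x, (q j).[x] @[j --> \oo] --> 0} ->
  (q j).[w] @[j --> \oo] --> v ->
  `|v| <= A * \prod_(x <- s) (`|w - x| / (r - n0)).
Proof.
move=> + + + nr wr; elim: s q A v => [|z s IH] q A v /=.
  move=> _ _ _ qA _ qv; rewrite big_nil mulr1.
  apply: (cvgr_to_le (cvg_norm qv)); apply: nearW => j.
  by apply: le_trans (qA j); exact: horner_nrm.
move=> /andP[zs us]; rewrite inE negb_or => /andP[wz ws] sn qA q0 qv.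
have zn : `|z| <= n0 by apply: sn; rewrite mem_head.
have dE x j : x != z -> (ddiv z (q j)).[x] = ((q j).[x] - (q j).[z]) / (x - z).
  by move=> xz; rewrite [(q j).[x]](ddivE z) addrAC subrr add0r mulrC mulKf// subr_eq0.
have qz : (q j).[z] @[j --> \oo] --> 0 by apply: q0; rewrite mem_head.
have := IH (fun j => ddiv z (q j)) (A / (r - n0)) (v / (w - z)) us ws.
have -> : `|v / (w - z)| = `|v| / `|w - z| by rewrite normf_div.
rewrite big_cons ler_pdivrMr ?normr_gt0 ?subr_eq0//.
move=> h; rewrite (_ : A * _ = (A / (r - n0)) *
   \prod_(x <- s) (`|w - x| / (r - n0)) * `|w - z|); last by ring.
apply: h.
- by move=> x xs; apply: sn; rewrite inE xs orbT.
- move=> j; apply: (le_trans (nrm_ddiv_le _ zn nr)).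
  by rewrite ler_wpM2r// invr_ge0 subr_ge0 ltW.
- move=> x xs; have xz : x != z by apply: contraNneq zs => <-.
  rewrite (_ : (fun j => _) = (fun j => ((q j).[x] - (q j).[z]) / (x - z))).
    rewrite -[X in _ --> X](mul0r (x - z)^-1) -[X in X / _]subr0.
    by apply: cvgMr_tmp; apply: cvgB => //; apply: q0; rewrite inE xs orbT.
  by apply/funext => j; exact: dE.
- rewrite (_ : (fun j => _) = (fun j => ((q j).[w] - (q j).[z]) / (w - z))).
    by rewrite -[X in X / _]subr0; apply: cvgMr_tmp; exact: cvgB.
  by apply/funext => j; exact: dE.
Qed.

(** Its value at [x] is the divided difference of [p] at the nodes [s] and [x]. *)
Fixpoint ddivs s p : {poly R} := if s is z :: s' then ddivs s' (ddiv z p) else p.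

Lemma nrm_ddivs r n0 s p : {in s, forall x, `|x| <= n0} -> n0 < r ->
  nrm r (ddivs s p) <= nrm r p / (r - n0) ^+ size s.
Proof.
move=> + nr; elim: s p => [|z s IH] p sn /=; first by rewrite expr0 divr1.
apply: (le_trans (IH _ _)) => [x xs|]; first by apply: sn; rewrite inE xs orbT.
rewrite exprS invfM mulrA ler_wpM2r ?invr_ge0 ?exprn_ge0 ?subr_ge0 ?(ltW nr)//.
by apply: nrm_ddiv_le => //; apply: sn; rewrite mem_head.
Qed.

Lemma newton s p x : p.[x] =
  \sum_(l < size s) (ddivs (take l s) p).[s`_l] * \prod_(k < l) (x - s`_k)
  + (ddivs s p).[x] * \prod_(k < size s) (x - s`_k).
Proof.
elim: s p => [|z s IH] p /=; first by rewrite !big_ord0 add0r mulr1.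
rewrite big_ord_recl/= big_ord0 mulr1 (ddivE z) (IH (ddiv z p)) mulrDr -addrA.
congr (_ + _); congr (_ + _).
  rewrite mulr_sumr; apply: eq_bigr => i _; rewrite big_ord_recl/=.
  by rewrite mulrCA; congr (_ * (_ * _)); apply: eq_bigr.
rewrite mulrCA big_ord_recl/=; congr (_ * (_ * _)).
Qed.

Lemma det_le n (A : 'M[R]_n) (b : 'I_n -> R) : (forall i j, `|A i j| <= b i) ->
  `|\det A| <= n`!%:R * \prod_i b i.
Proof.
move=> Ab; apply: (le_trans (ler_norm_sum _ _ _)).
apply: (@le_trans _ _ (\sum_(s : 'S_n) \prod_i b i)).
  apply: ler_sum => s _; rewrite normrM normrX normrN1 expr1n mul1r normr_prod.
  by apply: ler_prod => i _; rewrite normr_ge0 Ab.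
by rewrite sumr_const card_Sn mulr_natl.
Qed.

(** Newton interpolation factors the matrix as [L *m A] with [L] lower
triangular and with diagonal entries of modulus at most [1], since the nodes are
close to each other, while the rows of [A], being divided differences of
increasing order, decrease geometrically. *)
Lemma det_interp_le N r n0 B (z : 'I_N -> R) (p : 'I_N -> {poly R}) :
  (forall i, `|z i| <= n0) -> (forall i j, `|z i - z j| <= 1) -> n0 < r -> 0 <= r ->
  (forall j, nrm r (p j) <= B) ->
  `|\det (\matrix_(i, j) (p j).[z i])| <=
    N`!%:R * \prod_(i < N) (B / (r - n0) ^+ i).
Proof.
move=> zn z1 nr r0 pB.
pose s := [seq z i | i <- enum 'I_N].
have ss : size s = N by rewrite size_map size_enum_ord.
have sE (i : 'I_N) : s`_i = z i.
  by rewrite (nth_map i) ?size_enum_ord// nth_ord_enum.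
have sn : {in s, forall x, `|x| <= n0} by move=> x /mapP[i _ ->].
pose L := \matrix_(i < N, l < N) \prod_(k < l) (z i - s`_k).
pose A := \matrix_(l < N, j < N) (ddivs (take l s) (p j)).[z l].
have -> : \matrix_(i, j) (p j).[z i] = L *m A.
  apply/matrixP => i j; rewrite !mxE (newton s (p j)).
  rewrite [X in _ + X](_ : _ = 0) ?addr0; last first.
    have ii : (i < size s)%N by rewrite ss.
    by rewrite (bigD1 (Ordinal ii))//= sE subrr mul0r mulr0.
  rewrite -(big_mkord xpredT (fun l => (ddivs (take l s) (p j)).[s`_l] * \prod_(k < l) (z i - s`_k))).
  rewrite ss big_mkord; apply: eq_bigr => l _.
  by rewrite !mxE sE mulrC.
rewrite det_mulmx normrM -[leRHS]mul1r ler_pM//.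
  rewrite det_trig.
    rewrite normr_prod; apply: prodr_ile1 => i _; rewrite normr_ge0/= mxE.
    rewrite normr_prod; apply: prodr_ile1 => k _; rewrite normr_ge0/=.
    have kN : (k < N)%N by apply: ltn_trans (ltn_ord i).
    by rewrite (sE (Ordinal kN)).
  apply/is_trig_mxP => i l il; rewrite mxE.
  by rewrite (bigD1 (Ordinal il))//= sE subrr mul0r.
apply: det_le => l j; rewrite mxE.
have lr : `|z l| <= r by apply: (le_trans (zn l)); exact: ltW.
apply: (le_trans (horner_nrm _ lr)).
have sl : {in take l s, forall x, `|x| <= n0} by move=> x /mem_take; exact: sn.
apply: (le_trans (nrm_ddivs _ sl nr)).
rewrite size_takel ?ss 1?ltnW//.
by rewrite ler_wpM2r// invr_ge0 exprn_ge0// subr_ge0 ltW.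
Qed.

(** Induction on the nodes: a divided difference at [z] has one degree less,
and values at most [2 * V / g] on the other nodes. *)
Lemma nrm_interp g U V s q : (size q <= size s)%N -> uniq s ->
  {in s &, forall x y, x != y -> g <= `|x - y|} -> {in s, forall x, `|x| <= U} ->
  {in s, forall x, `|q.[x]| <= V} -> 0 < g -> 0 <= U -> 0 <= V ->
  nrm 1 q <= V * (1 + 2 * (1 + U) / g) ^+ size s.
Proof.
move=> + + + + + g0 U0; elim: s q V => [|z s IH] q V /=.
  rewrite leqn0 size_poly_eq0 => /eqP -> _ _ _ _ V0.
  by rewrite nrm0 mulr1.
move=> sq /andP[zs us] sg sU sV V0.
have c1 : 0 <= 2 * (1 + U) / g by rewrite divr_ge0 ?(ltW g0)//; lra.
have qz : `|q.[z]| <= V by apply: sV; rewrite mem_head.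
have h : nrm 1 (ddiv z q) <= 2 * V / g * (1 + 2 * (1 + U) / g) ^+ size s.
  apply: IH => //; first exact: size_ddiv.
  - by move=> x y xs ys; apply: sg; rewrite inE ?xs ?ys orbT.
  - by move=> x xs; apply: sU; rewrite inE xs orbT.
  - move=> x xs; have xz : x != z by apply: contraNneq zs => <-.
    have x0 : 0 < `|x - z| by rewrite normr_gt0 subr_eq0.
    have -> : (ddiv z q).[x] = (q.[x] - q.[z]) / (x - z).
      by rewrite [q.[x]](ddivE z) addrAC subrr add0r mulrC mulKf// subr_eq0.
    rewrite normf_div ler_pM ?invr_ge0//.
      rewrite (le_trans (ler_normB _ _))// mulr_natl mulr2n lerD// sV// inE xs orbT//.
    by rewrite lef_pV2 ?posrE// sg// ?inE ?xs ?eqxx ?orbT.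
  - by rewrite divr_ge0 ?(ltW g0)// mulr_ge0.
have zU : `|z| <= U by apply: sU; rewrite mem_head.
rewrite (ddivP z q); apply: (le_trans (nrmD _ _ ler01)); rewrite nrmC.
have hX : nrm 1 ('X - z%:P) <= 1 + U.
  have := nrm_MXaddC 1 1 (- z).
  by rewrite mul1r polyCN mul1r -polyC1 nrmC normr1 normrN => ->; rewrite lerD2l.
apply: (@le_trans _ _ (V + 2 * V / g * (1 + 2 * (1 + U) / g) ^+ size s * (1 + U))).
  apply: lerD => //; apply: (le_trans (nrmM _ _ ler01)).
  by apply: ler_pM => //; apply: nrm_ge0.
rewrite exprS; set c := 2 * (1 + U) / g in c1 *.
have hc : 1 <= (1 + c) ^+ size s by rewrite exprn_ege1// lerDl.
set e := (1 + c) ^+ _ in hc *.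
have -> : 2 * V / g * e * (1 + U) = V * c * e by rewrite /c; ring.
by have := ler_wpM2l V0 hc; nra.
Qed.
End PolyNorm.

(** * Polynomial approximants of the reciprocal Gamma function *)

Section Approximants.
Variable R : realType.
Implicit Types (x c u : R) (m K k : nat).

(** Truncation of the series of [expR (c * x)]. *)
Definition expp K c : {poly R} := \sum_(j < K) (c ^+ j / j`!%:R) *: 'X^j.

Lemma horner_expp K c x : (expp K c).[x] = series (exp_coeff (c * x)) K.
Proof.
rewrite /expp horner_sum /series/= big_mkord; apply: eq_bigr => j _.
by rewrite !hornerE /exp_coeff/= exprMn mulrAC.
Qed.

Lemma cvg_expp c x : (expp K c).[x] @[K --> \oo] --> expR (c * x).
Proof.
rewrite (_ : (fun K => _) = series (exp_coeff (c * x))).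
  exact: is_cvg_series_exp_coeff.
by apply/funext => K; exact: horner_expp.
Qed.

Lemma series_exp_le x K : 0 <= x -> series (exp_coeff x) K <= expR x.
Proof.
move=> x0; apply: nondecreasing_cvgn_le; last exact: is_cvg_series_exp_coeff.
apply: nondecreasing_series => n _ _; exact: exp_coeff_ge0.
Qed.

Lemma nrm_expp r K c : 0 <= r -> nrm r (expp K c) <= expR (`|c| * r).
Proof.
move=> r0; apply: le_trans (series_exp_le K _); last by rewrite mulr_ge0.
apply: (le_trans (nrm_sum _ _ _ r0)); rewrite /series/= big_mkord.
apply: ler_sum => j _; rewrite nrmZ nrmXn /exp_coeff/= exprMn.
by rewrite normrM normrX normfV (ger0_norm (ler0n _ _)) mulrAC.
Qed.

(** Since [ln (1 + 1 / k) = 1 / k + O(1 / k ^ 2)], this polynomial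
approximates [(1 + x / k) * (1 + 1 / k) `^ (- x)], where the linear terms in [x]
nearly cancel. This is the factor of index [k] in Gauss's product. *)
Definition factor K k : {poly R} :=
  (1 + k%:R^-1 *: 'X) * expp K (- ln (1 + k%:R^-1)).

Definition approx m K : {poly R} := 'X * \prod_(k < m) factor K k.+1.

Lemma gaussf_rec m x : gaussf m.+1 x =
  gaussf m x * ((1 + m.+1%:R^-1 * x) * expR (- ln (1 + m.+1%:R^-1) * x)).
Proof.
rewrite /gaussf big_ord_recr/= factS natrM.
have M0 : (0 : R) < m.+1%:R by rewrite ltr0n.
have -> : m.+2%:R `^ (- x) = m.+1%:R `^ (- x) * expR (- ln (1 + m.+1%:R^-1) * x).
  have -> : m.+2%:R = m.+1%:R * (1 + m.+1%:R^-1) :> R.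
    by rewrite mulrDr mulr1 mulfV ?natr1 ?gt_eqF.
  rewrite powRM ?(ltW M0)// ?addr_ge0 ?invr_ge0 ?(ltW M0)//; congr (_ * _).
  rewrite /powR gt_eqF; last by rewrite ltr_pwDl ?invr_ge0 ?(ltW M0).
  by congr expR; rewrite !mulNr mulrC.
by field; rewrite gt_eqF//= pnatr_eq0 -lt0n fact_gt0.
Qed.

Lemma cvg_approx m x : (approx m K).[x] @[K --> \oo] --> gaussf m x.
Proof.
elim: m => [|m IH].
  rewrite (_ : gaussf 0 x = x); last first.
    by rewrite /gaussf big_ord1 addr0 powR1 mulr1 divr1.
  rewrite (_ : (fun K => _) = fun=> x); first exact: cvg_cst.
  by apply/funext => K; rewrite /approx big_ord0 mulr1 hornerX.
rewrite gaussf_rec (_ : (fun K => _) = (fun K => (approx m K).[x] *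
   ((1 + m.+1%:R^-1 * x) * (expp K (- ln (1 + m.+1%:R^-1))).[x]))).
  by apply: cvgM => //; apply: cvgMl_tmp; exact: cvg_expp.
by apply/funext => K; rewrite /approx big_ord_recr/= mulrA !hornerE.
Qed.

Lemma lnD1_bounds u : 0 <= u -> u - u ^+ 2 <= ln (1 + u) <= u.
Proof.
move=> u0; apply/andP; split; last by apply: le_ln1Dx; lra.
have u1 : 0 < 1 + u by lra.
have -> : ln (1 + u) = - ln (1 + - (u / (1 + u))).
  rewrite -lnV ?posrE//.
    by congr ln; field; rewrite gt_eqF//= subr_eq0 gt_eqF; lra.
  by rewrite subr_gt0 ltr_pdivrMr//; lra.
rewrite lerNr; apply: (@le_trans _ _ (- (u / (1 + u)))).
  by apply: le_ln1Dx; rewrite ltrN2 ltr_pdivrMr//; lra.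
rewrite lerN2 ler_pdivlMr//.
have -> : (u - u ^+ 2) * (1 + u) = u - u ^+ 3 by ring.
by rewrite gerBl exprn_ge0.
Qed.

Lemma expR1_le4 : expR 1 <= (4 : R).
Proof.
have -> : 1 = 2^-1 + 2^-1 :> R by lra.
rewrite expRD; have h : expR 2^-1 <= (2 : R).
  rewrite -[leLHS]invrK -expRN -[leRHS]invrK lef_pV2 ?posrE ?expR_gt0 ?invr_gt0//.
  have := expR_ge1Dx (- 2^-1 : R); lra.
have := expR_gt0 (2^-1 : R); nra.
Qed.

Lemma invn_ge0 k : 0 <= (k%:R^-1 : R). Proof. by rewrite invr_ge0. Qed.

Lemma nrm_1DZX r u : 0 <= u -> nrm r (1 + u *: 'X) = 1 + r * u.
Proof.
move=> u0; have := nrm_MXaddC r u%:P 1.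
by rewrite mul_polyC nrmC normr1 ger0_norm// polyC1 addrC [RHS]addrC.
Qed.

(** Meant for [k] below [r], where there is no cancellation to exploit. *)
Lemma nrm_factor r K k : 0 <= r -> nrm r (factor K k) <= expR (2 * (r / k%:R)).
Proof.
move=> r0; have u0 := invn_ge0 k; set u : R := k%:R^-1 in u0 *.
have /andP[_ lu] := lnD1_bounds u0.
have l0 : 0 <= ln (1 + u) by rewrite ln_ge0// lerDl.
rewrite mulr_natl mulr2n expRD; apply: (le_trans (nrmM _ _ r0)).
apply: ler_pM; rewrite ?nrm_ge0//.
  by rewrite nrm_1DZX// expR_ge1Dx.
apply: (le_trans (nrm_expp _ _ r0)).
by rewrite ler_expR normrN ger0_norm// mulrC ler_wpM2l.
Qed.

Lemma expp_split K c : expp K.+2 c =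
  1 + c *: 'X + c ^+ 2 *: (\sum_(j < K) (c ^+ j / j.+2`!%:R) *: 'X^j) * 'X^2.
Proof.
rewrite /expp -(big_mkord xpredT (fun j => (c ^+ j / j`!%:R) *: 'X^j)).
rewrite !big_nat_recl// big_mkord !expr0 !expr1 !divr1 scale1r -addrA.
congr (_ + (_ + _)).
rewrite scaler_sumr mulr_suml; apply: eq_bigr => j _.
rewrite -2!(scalerAl _ _ 'X^2) scalerA -exprD addn2; congr (_ *: _).
have e : c ^+ j.+2 = c ^+ 2 * c ^+ j by rewrite -exprD add2n.
by rewrite e -mulrA.
Qed.

(** For [k] above [r]: the first-order terms cancel up to [r / k ^ 2], so
that the logarithms of the norms are summable over [k]. *)
Lemma nrm_factor_sqr r K k : 1 <= r -> r <= k%:R ->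
  nrm r (factor K.+2 k) <= expR (10 * (r / k%:R) ^+ 2).
Proof.
move=> r1 rk; have r0 : 0 <= r by lra.
have k0 : 0 < k%:R :> R by lra.
have u0 := invn_ge0 k; rewrite /factor; set u : R := k%:R^-1 in u0 *.
have ru : r * u <= 1 by rewrite ler_pdivrMr// mul1r.
have /andP[ul lu] := lnD1_bounds u0.
have l0 : 0 <= ln (1 + u) by rewrite ln_ge0// lerDl.
set l := ln _ in ul lu l0 *.
rewrite expp_split; set T := \sum_(_ < _) _.
have T4 : nrm r T <= 4.
  apply: (le_trans _ expR1_le4).
  apply: (@le_trans _ _ (expR (l * r))); last first.
    by rewrite ler_expR; apply: le_trans ru; rewrite mulrC ler_wpM2l.
  apply: le_trans (series_exp_le K _); last by rewrite mulr_ge0.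
  apply: (le_trans (nrm_sum _ _ _ r0)); rewrite /series/= big_mkord.
  apply: ler_sum => j _; rewrite nrmZ nrmXn /exp_coeff/= exprMn.
  rewrite normrM normrX normrN (ger0_norm l0) normfV (ger0_norm (ler0n _ _)) mulrAC.
  rewrite ler_wpM2l ?mulr_ge0 ?exprn_ge0// lef_pV2 ?posrE ?ltr0n ?fact_gt0//.
  by rewrite ler_nat leq_fact// leqW.
have -> : (1 + u *: 'X) * (1 + (- l) *: 'X + (- l) ^+ 2 *: T * 'X^2) =
  1 + (u - l) *: 'X + - (u * l) *: 'X^2 + (1 + u *: 'X) * (l ^+ 2 *: T * 'X^2).
  rewrite sqrrN -!mul_polyC !polyCN polyCB polyCM; ring.
have n1 : nrm r (1 + u *: 'X) = 1 + r * u.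
  by rewrite nrm_1DZX.
have n2 : nrm r ((u - l) *: 'X) = (u - l) * r.
  by rewrite -['X]expr1 nrmZ nrmXn expr1 ger0_norm// subr_ge0.
have n3 : nrm r (- (u * l) *: 'X^2) = u * l * r ^+ 2.
  by rewrite nrmZ nrmXn normrN ger0_norm// mulr_ge0.
have n4 : nrm r (l ^+ 2 *: T * 'X^2) = r ^+ 2 * (l ^+ 2 * nrm r T).
  by rewrite nrmMXn nrmZ ger0_norm// exprn_ge0.
apply: (le_trans (nrmD _ _ r0)); apply: le_trans (expR_ge1Dx _).
apply: (le_trans (lerD (nrmD _ _ r0) (nrmM _ _ r0))).
rewrite n1 n3 n4.
apply: (le_trans (lerD (lerD (nrmD _ _ r0) (lexx _)) (lexx _))).
rewrite n2 -polyC1 nrmC normr1.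
have h1 : (u - l) * r <= (r * u) ^+ 2.
  apply: (@le_trans _ _ (u ^+ 2 * r)); first by rewrite ler_wpM2r//; lra.
  by rewrite exprMn mulrC ler_wpM2r ?exprn_ge0// expr2 ler_peMl.
have h2 : u * l * r ^+ 2 <= (r * u) ^+ 2.
  by rewrite exprMn mulrC ler_wpM2l ?exprn_ge0// expr2 ler_wpM2l.
have h3 : (1 + r * u) * (r ^+ 2 * (l ^+ 2 * nrm r T)) <= 2 * ((r * u) ^+ 2 * 4).
  apply: ler_pM; rewrite ?mulr_ge0 ?exprn_ge0 ?nrm_ge0//; [by rewrite addr_ge0 ?mulr_ge0|lra|].
  rewrite exprMn -[leRHS]mulrA ler_wpM2l ?exprn_ge0//.
  apply: ler_pM; [exact: exprn_ge0|exact: nrm_ge0| |exact: T4].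
  by rewrite lerXn2r ?nnegrE.
lra.
Qed.

(** The sum of [2 * r / k] is a harmonic sum, whence the logarithm; it is
responsible for the growth [r ^ r]. *)
Lemma nrm_prod_factor_le r m K : (m <= r)%N ->
  nrm r%:R (\prod_(k < m.+1) factor K k.+1) <= expR (2 * r%:R * (1 + ln m.+1%:R)).
Proof.
have r0 : 0 <= r%:R :> R by [].
elim: m => [|m IH] mr.
  rewrite big_ord1 ln1 addr0 mulr1; apply: (le_trans (nrm_factor _ _ r0)).
  by rewrite divr1.
rewrite big_ord_recr/=; apply: (le_trans (nrmM _ _ r0)).
apply: (le_trans (ler_pM (nrm_ge0 _ r0) (nrm_ge0 _ r0) (IH (ltnW mr)) (nrm_factor _ _ r0))).
rewrite -expRD ler_expR mulrA -mulrDr -addrA ler_wpM2l ?mulr_ge0// lerD2l -lerBrDl.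
have m1 : 0 < m.+1%:R :> R by rewrite ltr0n.
have m2 : 0 < m.+2%:R :> R by rewrite ltr0n.
rewrite -ln_div ?posrE// -[leLHS]opprK lerNl -lnV ?posrE ?divr_gt0// invf_div.
have -> : m.+1%:R / m.+2%:R = 1 + - m.+2%:R^-1 :> R.
  have -> : m.+1%:R = m.+2%:R - 1 :> R by rewrite -[m.+2%:R]natr1 addrK.
  by rewrite mulrBl divff ?gt_eqF// mul1r.
by apply: le_ln1Dx; rewrite ltrN2 invf_lt1// ltr1n.
Qed.

(** [1 / Gamma] has order one, uniformly along its approximants. Up to [r]
the factors contribute a harmonic sum, and beyond [r] a sum of
[10 * (r / k) ^ 2], bounded by [10 * r] by telescoping. *)
Lemma nrm_approx r m K : (4 <= r)%N -> nrm r%:R (approx m K.+2) <= r%:R ^+ (15 * r).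
Proof.
move=> r4.
have r0 : 0 < r%:R :> R by rewrite ltr0n; apply: leq_trans r4.
have r1 : 1 <= r%:R :> R by rewrite ler1n; apply: leq_trans r4.
pose b : R := 2 * r%:R * (1 + ln r%:R).
have small j : (j <= r)%N -> nrm r%:R (\prod_(k < j) factor K.+2 k.+1) <= expR b.
  case: j => [|j] jr.
    rewrite big_ord0 -polyC1 nrmC normr1 -[leLHS]expR0 ler_expR.
    by rewrite !mulr_ge0// addr_ge0// ln_ge0.
  apply: (le_trans (nrm_prod_factor_le _ (ltnW jr))).
  by rewrite ler_expR ler_wpM2l ?mulr_ge0// lerD2l ler_ln ?posrE// ler_nat.
have large d : nrm r%:R (\prod_(k < r + d) factor K.+2 k.+1) <=
    expR (b + 10 * r%:R ^+ 2 * (r%:R^-1 - (r + d)%:R^-1)).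
  elim: d => [|d IH]; first by rewrite addn0 subrr mulr0 addr0 small.
  rewrite addnS big_ord_recr/=; apply: (le_trans (nrmM _ _ (ltW r0))).
  have rd : r%:R <= (r + d).+1%:R :> R by rewrite ler_nat leqW// leq_addr.
  apply: (le_trans (ler_pM (nrm_ge0 _ (ltW r0)) (nrm_ge0 _ (ltW r0)) IH
    (nrm_factor_sqr _ r1 rd))).
  rewrite -expRD ler_expR -addrA lerD2l exprMn [10 * (_ ^+ 2 * _)]mulrA -mulrDr.
  rewrite ler_wpM2l ?mulr_ge0 ?exprn_ge0 ?(ltW r0)//.
  rewrite -addrA lerD2l addrC -lerBrDr opprK addrC.
  have m0 : 0 < (r + d)%:R :> R by rewrite ltr0n addn_gt0 (leq_trans _ r4).
  rewrite -natr1; set y := _%:R in m0 *.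
  have -> : y^-1 - (y + 1)^-1 = (y * (y + 1))^-1.
    by field; rewrite !gt_eqF//; lra.
  rewrite exprVn lef_pV2 ?posrE ?exprn_gt0 ?mulr_gt0//; nra.
have main : nrm r%:R (\prod_(k < m) factor K.+2 k.+1) <= expR (b + 10 * r%:R).
  have [mr|rm] := leqP m r.
    by apply: (le_trans (small _ mr)); rewrite ler_expR lerDl mulr_ge0.
  rewrite -(subnKC (ltnW rm)); apply: (le_trans (large _)).
  rewrite ler_expR lerD2l expr2 -!mulrA ler_wpM2l// mulrBr mulfV ?gt_eqF//.
  by rewrite ler_piMr ?(ltW r0)// gerBl mulr_ge0 ?invn_ge0.
rewrite /approx; apply: (le_trans (nrmM _ _ (ltW r0))).
rewrite -['X]expr1 nrmXn expr1.
apply: (le_trans (ler_wpM2l (ltW r0) main)).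
have -> : b + 10 * r%:R = (2 * r)%:R * ln r%:R + (12 * r)%:R * 1.
  by rewrite /b !natrM; ring.
rewrite expRD !expRM_natl lnK ?posrE//.
have e1 : expR 1 ^+ (12 * r) <= r%:R ^+ (12 * r) :> R.
  rewrite lerXn2r ?nnegrE ?expR_ge0 ?(ltW r0)//.
  by apply: (le_trans expR1_le4); rewrite ler_nat.
apply: (le_trans (ler_wpM2l (ltW r0) (ler_wpM2l (exprn_ge0 _ (ltW r0)) e1))).
by rewrite -exprD -exprS; apply: ler_weXn2l => //; lia.
Qed.

(** Choosing, for each [m], a truncation order good to within [1 / (m + 1)] at
the finitely many points of [S] merges the two limits into one sequence. It
converges wherever Gauss's product does, in particular to the left of [0]. *)
Lemma approx_seq (S : seq R) : exists p : nat -> {poly R},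
  (forall j r, (4 <= r)%N -> nrm r%:R (p j) <= r%:R ^+ (15 * r)) /\
  {in S, forall x (l : R), gaussf m x @[m --> \oo] --> l -> (p j).[x] @[j --> \oo] --> l}.
Proof.
have near_m m : exists K,
    {in S, forall x, `|gaussf m x - (approx m K.+2).[x]| < m.+1%:R^-1}.
  have : \forall K \near \oo,
      {in S, forall x, `|gaussf m x - (approx m K).[x]| < m.+1%:R^-1}.
    elim: S => [|y S IH]; first by apply: nearW => K x.
    have h : \forall K \near \oo, `|gaussf m y - (approx m K).[y]| < m.+1%:R^-1.
      have /cvgrPdist_lt/(_ m.+1%:R^-1) := @cvg_approx m y.
      by apply; rewrite invr_gt0.
    near=> K => x; rewrite inE => /predU1P[->|xS]; first by near: K.
    by move: x xS; near: K.
  case=> N _ NP; exists N => x xS; apply: NP => //=.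
  by apply: leqW; apply: leqW.
have [K KP] := choice near_m.
exists (fun m => approx m (K m).+2); split; first by move=> j r; exact: nrm_approx.
move=> x xS l lP.
have -> : (fun j => (approx j (K j).+2).[x]) =
  (fun j => gaussf j x - (gaussf j x - (approx j (K j).+2).[x])).
  by apply/funext => j; rewrite subKr.
rewrite -[X in _ --> X]subr0; apply: cvgB => //.
apply/cvgrPdist_lt => e e0.
have := @cvg_harmonic R => /cvgrPdist_lt/(_ e e0); apply: filterS => j.
rewrite !sub0r !normrN; apply: lt_trans.
by rewrite [ltRHS]ger0_norm ?invr_ge0// KP.
Unshelve. all: by end_near. Qed.
End Approximants.

(** * The zero estimate *)

Section ZeroEstimate.
Variable R : realType.
Implicit Types (x y t w : R).

Lemma leq_expn_fact j d : (j ^ d <= (j + d)`!)%N.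
Proof.
elim: d => [|d IH]; first by rewrite expn0 fact_gt0.
by rewrite addnS factS expnS leq_mul// -addnS leq_addr.
Qed.

Lemma zeros_exponent N : (64 <= N)%N ->
  (4 * (N ^ 2 * (50 * N) ^ ((750 * N).+1 * N) * N ^ (4 * N)) <= N ^ (1510 * N ^ 2))%N.
Proof.
move=> N64; have N0 : (0 < N)%N by apply: leq_trans N64.
apply: (@leq_trans (N * (N ^ 2 * (N ^ 2) ^ ((750 * N).+1 * N) * N ^ (4 * N)))).
  apply: leq_mul; first exact: leq_trans N64.
  rewrite leq_mul2r leq_mul2l leq_exp2r ?muln_gt0//.
  by rewrite -mulnn leq_mul2r (leq_trans _ N64) ?orbT.
by rewrite -expnM -!expnD -expnS leq_exp2l; nia.
Qed.

Lemma fact_exponent N : (64 <= N)%N ->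
  (4 * (N ^ 3 * (13 * N) ^ N * N ^ (4 * N)) <= (12 * N)`!)%N.
Proof.
move=> N64; have N0 : (0 < N)%N by apply: leq_trans N64.
have -> : (12 * N = N + 11 * N)%N by rewrite -mulSn.
apply: leq_trans (leq_expn_fact _ _).
apply: (@leq_trans (N * (N ^ 3 * (N ^ 2) ^ N * N ^ (4 * N)))).
  apply: leq_mul; first exact: leq_trans N64.
  rewrite leq_mul2r leq_mul2l leq_exp2r//.
  by rewrite -mulnn leq_mul2r (leq_trans _ N64) ?orbT.
by rewrite -expnM -!expnD -expnS leq_exp2l; nia.
Qed.

Lemma dist_expr_le K u v a : 1 <= K -> `|u| <= K -> `|v| <= K ->
  `|u ^+ a - v ^+ a| <= a%:R * `|u - v| * K ^+ a :> R.
Proof.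
move=> K1 uK vK; have K0 : 0 <= K by lra.
elim: a => [|a IH]; first by rewrite !expr0 subrr normr0 !mul0r.
have -> : u ^+ a.+1 - v ^+ a.+1 = u * (u ^+ a - v ^+ a) + (u - v) * v ^+ a.
  by rewrite !exprS; ring.
apply: (le_trans (ler_normD _ _)); rewrite !normrM -natr1 mulrDl mul1r mulrDl.
apply: lerD.
  by rewrite exprS mulrCA ler_pM.
rewrite ler_wpM2l// normrX (@le_trans _ _ (K ^+ a))//.
  by rewrite lerXn2r ?nnegrE.
by rewrite exprS ler_peMl// exprn_ge0.
Qed.

Lemma prod_1B_bounds t k : 0 <= t -> k%:R * t <= 1 ->
  1 - k%:R * t <= \prod_(j < k) (1 - t / j.+1%:R) <= 1.
Proof.
move=> t0; elim: k => [|k IH] kt; first by rewrite big_ord0 mul0r subr0 lexx.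
rewrite big_ord_recr/=; move: kt; rewrite -natr1 mulrDl mul1r => kt.
have kt0 : 0 <= k%:R * t by rewrite mulr_ge0.
have /IH/andP[] : k%:R * t <= 1 by lra.
set p := \prod_(_ < _) _ => p1 p2.
set u := t / _; have u0 : 0 <= u by rewrite divr_ge0// natr1.
have ut : u <= t by rewrite ler_pdivrMr natr1// ler_peMr// ler1n.
by apply/andP; split; nra.
Qed.

Lemma prod_sub_sign t k :
  \prod_(j < k) (t - j.+1%:R) = (-1) ^+ k * k`!%:R * \prod_(j < k) (1 - t / j.+1%:R).
Proof.
elim: k => [|k IH]; first by rewrite !big_ord0 !mulr1.
rewrite !big_ord_recr/= IH factS natrM exprSr.
have k0 : k.+1%:R != 0 :> R by rewrite pnatr_eq0.
rewrite -[X in _ * X = _](_ : - k.+1%:R * (1 - t / k.+1%:R) = _); last by field; rewrite nat1r.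
ring.
Qed.

(** The continuation of [1 / Gamma] at [t - k]. *)
Definition invGammaB k t : R := (\prod_(j < k) (t - j.+1%:R)) / Gamma t.

(** Near its zero [- k] the function [1 / Gamma] is nearly linear, with the
very steep slope [(-1) ^ k * k!]. *)
Lemma invGammaBE k t : 0 < t -> k%:R * t <= 1 -> t <= 1 ->
  exists2 e, `|e| <= k%:R * t + t & invGammaB k t = (-1) ^+ k * (k`!%:R * t * (1 + e)).
Proof.
move=> t0 kt t1; have t01 : 0 < t <= 1 by rewrite t0.
have /andP[g1 g2] := invGamma_near0 t01.
have /andP[p1 p2] := prod_1B_bounds (ltW t0) kt.
rewrite /invGammaB prod_sub_sign.
set p := \prod_(j < k) (1 - _) in p1 p2 *; set g := (Gamma t)^-1 in g1 g2 *.
exists (p * (g / t) - 1); last by field; rewrite gt_eqF.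
have h1 : 1 <= g / t by rewrite ler_pdivlMr// mul1r.
have h2 : g / t <= 1 + t by rewrite ler_pdivrMr// mulrC.
rewrite ler_norml; apply/andP; split; nra.
Qed.

Lemma natr_dist_ge1 (a b : nat) : a != b -> 1 <= `|a%:R - b%:R| :> R.
Proof.
wlog ab : a b / (b < a)%N.
  move=> H ne; have := ne; rewrite neq_ltn => /orP[h|h]; last exact: H.
  by rewrite distrC; apply: H => //; rewrite eq_sym.
by rewrite -natrB 1?ltnW// ger0_norm// ler1n subn_gt0.
Qed.

Section Nodes.
Variables (N k : nat).
Hypothesis Nk : (4 * N < k)%N.
Hypothesis N0 : (0 < N)%N.

(** At distance [node l] to the right of [- k], the function [1 / Gamma] is
close to [(l + 1) / (4 * N)] up to sign: within a tiny interval it visits [N]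
well separated values. *)
Definition node (l : 'I_N) : R := l.+1%:R / (4 * N%:R * k`!%:R).

Let kf : (0 : R) < k`!%:R. Proof. by rewrite ltr0n fact_gt0. Qed.
Let Np : (1 : R) <= N%:R. Proof. by rewrite ler1n. Qed.

Lemma node_gt0 l : 0 < node l.
Proof. by rewrite /node divr_gt0 ?mulr_gt0// (lt_le_trans ltr01 Np). Qed.

Lemma fact_node l : k`!%:R * node l = l.+1%:R / (4 * N%:R).
Proof.
have Np' := Np; have kf' := kf.
by rewrite /node; field; rewrite !gt_eqF//; lra.
Qed.

Lemma fact_node_le l : k`!%:R * node l <= 4^-1.
Proof.
have Np' := Np; rewrite fact_node ler_pdivrMr; last lra.
have : l.+1%:R <= N%:R :> R by rewrite ler_nat.
lra.
Qed.

Lemma node_mul_le l : k%:R * node l <= (16 * N%:R)^-1.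
Proof.
have Np' := Np.
have kE : k`!%:R = k%:R * k.-1`!%:R :> R.
  by case: k Nk => // k' _; rewrite factS natrM.
have := fact_node_le l; rewrite kE mulrAC => h.
have NF : 4 * N%:R <= k.-1`!%:R :> R.
  by rewrite -natrM ler_nat (leq_trans _ (fact_geq _))//; case: k Nk.
have t0 : 0 <= k%:R * node l by rewrite mulr_ge0// ltW// node_gt0.
rewrite -[leRHS]mul1r ler_pdivlMr; last lra.
have := ler_wpM2l t0 NF; lra.
Qed.

Lemma node_le l : node l <= (16 * N%:R)^-1.
Proof.
apply: le_trans (node_mul_le l); rewrite ler_peMl ?(ltW (node_gt0 l))//.
by rewrite ler1n; apply: leq_ltn_trans Nk.
Qed.

Lemma invGammaB_node l : exists2 d, `|d| <= (32 * N%:R)^-1 &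
  invGammaB k (node l) = (-1) ^+ k * (l.+1%:R / (4 * N%:R) + d).
Proof.
have Np' := Np.
have iN : (16 * N%:R)^-1 <= (16 : R)^-1.
  by rewrite lef_pV2 ?posrE//; lra.
have h1 := node_mul_le l; have h2 := node_le l.
have [||e eP ->] := @invGammaBE k _ (node_gt0 l); [lra..|].
exists (l.+1%:R / (4 * N%:R) * e); last first.
  by rewrite fact_node; ring.
rewrite -fact_node normrM ger0_norm; last by rewrite mulr_ge0 ?(ltW kf) ?(ltW (node_gt0 l)).
have -> : (32 * N%:R)^-1 = 4^-1 * ((16 * N%:R)^-1 + (16 * N%:R)^-1) :> R.
  by field; rewrite gt_eqF//; lra.
apply: ler_pM => //; first by rewrite mulr_ge0 ?(ltW kf) ?(ltW (node_gt0 l)).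
  exact: fact_node_le.
by apply: (le_trans eP); apply: lerD.
Qed.

Lemma invGammaB_node_norm l : `|invGammaB k (node l)| <= 1.
Proof.
have Np' := Np; have [d dP ->] := invGammaB_node l.
rewrite normrM normrX normrN1 expr1n mul1r (le_trans (ler_normD _ _))//.
have iN : (32 * N%:R)^-1 <= (32 : R)^-1 by rewrite lef_pV2 ?posrE//; lra.
have := fact_node_le l; rewrite fact_node => h.
rewrite ger0_norm; first lra.
by rewrite divr_ge0//; lra.
Qed.

Lemma invGammaB_node_gap l m : l != m ->
  (8 * N%:R)^-1 <= `|invGammaB k (node l) - invGammaB k (node m)|.
Proof.
have Np' := Np => lm.
have [d dP ->] := invGammaB_node l; have [e eP ->] := invGammaB_node m.
rewrite -mulrBr normrM normrX normrN1 expr1n mul1r.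
have -> : l.+1%:R / (4 * N%:R) + d - (m.+1%:R / (4 * N%:R) + e) =
  (l.+1%:R - m.+1%:R) / (4 * N%:R) - (e - d) by ring.
have lm1 : 1 <= `|l.+1%:R - m.+1%:R| :> R.
  by apply: natr_dist_ge1; rewrite eqSS.
apply: le_trans (lerB_dist _ _).
rewrite normrM normfV (ger0_norm (_ : 0 <= 4 * N%:R)); last lra.
have h : `|e - d| <= (32 * N%:R)^-1 + (32 * N%:R)^-1.
  by apply: (le_trans (ler_normB _ _)); exact: lerD.
have h2 : (4 * N%:R)^-1 <= `|l.+1%:R - m.+1%:R| / (4 * N%:R) :> R.
  by rewrite ler_peMl// invr_ge0; lra.
rewrite lerBrDr (le_trans _ h2)// (le_trans (lerD (lexx _) h))//.
rewrite -subr_ge0.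
have -> : (4 * N%:R)^-1 - ((8 * N%:R)^-1 + ((32 * N%:R)^-1 + (32 * N%:R)^-1)) =
  (16 * N%:R)^-1 :> R by field; rewrite gt_eqF//; lra.
by rewrite invr_ge0; lra.
Qed.

End Nodes.

Definition biv N (c : 'I_N -> 'I_N -> R) x y : R :=
  \sum_(a < N) \sum_(b < N) c a b * x ^+ a * y ^+ b.

Definition bivp N (c : 'I_N -> 'I_N -> R) (p : {poly R}) : {poly R} :=
  \sum_(a < N) \sum_(b < N) c a b *: ('X^a * p ^+ b).

Lemma horner_bivp N c p x : (@bivp N c p).[x] = biv c x p.[x].
Proof.
rewrite horner_sum; apply: eq_bigr => a _; rewrite horner_sum; apply: eq_bigr => b _.
by rewrite hornerZ hornerM hornerXn horner_exp mulrA.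
Qed.

Lemma cvg_exprn (u : nat -> R) (l : R) n :
  u j @[j --> \oo] --> l -> u j ^+ n @[j --> \oo] --> l ^+ n.
Proof.
move=> ul; elim: n => [|n IH]; first by rewrite expr0; exact: cvg_cst.
rewrite exprS (_ : (fun j => _) = fun j => u j * u j ^+ n); first exact: cvgM.
by apply/funext => j; rewrite exprS.
Qed.

Lemma cvg_bivp N (c : 'I_N -> 'I_N -> R) (p : nat -> {poly R}) x y :
  (p j).[x] @[j --> \oo] --> y -> (bivp c (p j)).[x] @[j --> \oo] --> biv c x y.
Proof.
move=> px; rewrite (_ : (fun j => _) = (fun j => biv c x (p j).[x])); last first.
  by apply/funext => j; rewrite horner_bivp.
apply: cvg_big => [|a _]; first exact: add_continuous.
apply: cvg_big => [|b _]; first exact: add_continuous.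
by apply: cvgMl_tmp; exact: cvg_exprn.
Qed.

Lemma sum_const_ord N (x : R) : \sum_(i < N) x = N%:R * x.
Proof. by rewrite sumr_const card_ord mulr_natl. Qed.

Lemma nrm_bivp N (c : 'I_N -> 'I_N -> R) S r B p : 1 <= r -> 1 <= B ->
  nrm r p <= B -> (forall a b, `|c a b| <= S) ->
  nrm r (bivp c p) <= N%:R ^+ 2 * (S * (r * B) ^+ N).
Proof.
move=> r1 B1 pB cS; have r0 : 0 <= r by lra. have B0 : 0 <= B by lra.
have -> : N%:R ^+ 2 * (S * (r * B) ^+ N) =
    \sum_(a < N) \sum_(b < N) S * (r * B) ^+ N.
  by rewrite !sum_const_ord expr2 -!mulrA.
apply: (le_trans (nrm_sum _ _ _ r0)); apply: ler_sum => a _.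
apply: (le_trans (nrm_sum _ _ _ r0)); apply: ler_sum => b _.
rewrite nrmZ; apply: ler_pM => //; first exact: nrm_ge0.
rewrite mulrC nrmMXn exprMn; apply: ler_pM; rewrite ?exprn_ge0 ?nrm_ge0//.
  by rewrite ler_weXn2l// ltnW.
apply: (le_trans (nrmX _ _ r0)); apply: (@le_trans _ _ (B ^+ b)).
  by rewrite lerXn2r ?nnegrE ?nrm_ge0.
by rewrite ler_weXn2l// ltnW.
Qed.

Lemma prod_seq_le (s : seq R) (F : R -> R) b : {in s, forall x, 0 <= F x <= b} ->
  \prod_(x <- s) F x <= b ^+ size s.
Proof.
elim: s => [|x s IH] H; first by rewrite big_nil.
rewrite big_cons exprS; have /andP[F0 Fb] := H x (mem_head _ _).
apply: ler_pM => //; last by apply: IH => y ys; apply: H; rewrite inE ys orbT.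
by rewrite big_seq; apply: prodr_ge0 => y ys; case/andP: (H y (mem_behead (s := x :: s) ys)).
Qed.

(** Smallness near [- k] of a function that vanishes on [s], by
[cvg_zeros_bound] on the disc of radius [50 * N]: each zero gains a factor [1 / 3],
because a point of [s] and a point near [- k] are at distance at most
[14 * N]. *)
Lemma biv_small N n k (l : 'I_N) (c : 'I_N -> 'I_N -> R) S (s : seq R) :
  (0 < N)%N -> (n <= N)%N -> (12 * N <= k < 13 * N)%N ->
  uniq s -> {in s, forall x, 0 < x <= n%:R} ->
  {in s, forall x, biv c x (Gamma x)^-1 = 0} ->
  (forall a b, `|c a b| <= S) -> 0 <= S ->
  `|biv c (node k l - k%:R) (invGammaB k (node k l))| <=
    S * (N%:R ^+ 2 * (50 * N)%:R ^+ ((750 * N).+1 * N) / 3 ^+ size s).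
Proof.
move=> N0 nN /andP[kN Nk] us sn sz cS S0.
have kN4 : (4 * N < k)%N by lia.
have r4 : (4 <= 50 * N)%N by lia.
have nr : (n < 50 * N)%N by lia.
have kr : (k <= 50 * N)%N by lia.
set t := node k l; have t0 : 0 < t by exact: node_gt0.
have tk : t <= (16 * N%:R)^-1 by exact: node_le.
have t1 : t < 1.
  apply: (le_lt_trans tk); rewrite invf_lt1 -?natrM ?ltr1n ?ltr0n//; lia.
have k1 : 1 <= k%:R :> R by rewrite ler1n; lia.
have kN' : k%:R <= 13 * N%:R :> R by rewrite -natrM ler_nat ltnW.
have nN' : n%:R <= N%:R :> R by rewrite ler_nat.
have N1 : 1 <= N%:R :> R by rewrite ler1n.
set w := t - k%:R.
have [p [pn pS]] := approx_seq (w :: s).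
have wl : `|w| <= k%:R by rewrite ler_norml /w; lra.
have r1 : 1 <= (50 * N)%:R :> R by rewrite ler1n (leq_trans _ r4).
have := @cvg_zeros_bound R (50 * N)%:R n%:R (S * (N%:R ^+ 2 * (50 * N)%:R ^+ ((750 * N).+1 * N))) s
  (fun j => bivp c (p j)) w (biv c w (invGammaB k t)) us.
move=> h; apply: le_trans (h _ _ _ _ _ _ _) _ => {h}.
- apply/negP => /sn; rewrite /w; lra.
- by move=> x /sn /andP[x0 xn]; rewrite ger0_norm// ltW.
- by rewrite ltr_nat.
- by apply: (le_trans wl); rewrite ler_nat.
- move=> j; rewrite mulrCA; apply: (le_trans (nrm_bivp r1 _ (pn j _ r4) cS)).
    by rewrite exprn_ege1.
  by rewrite -exprS -exprM mulnA.
- move=> x xs; rewrite -(sz x xs); apply: cvg_bivp.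
  apply: pS; first by rewrite inE xs orbT.
  by apply: gaussf_cvg; have /andP[] := sn x xs.
- apply: cvg_bivp; apply: pS; first by rewrite mem_head.
  exact: gaussf_cvgB.
- rewrite -!mulrA ler_wpM2l// mulrA [leRHS]mulrA ler_wpM2l ?mulr_ge0 ?exprn_ge0//.
  rewrite -exprVn ler_wpM2l ?exprn_ge0//; apply: prod_seq_le => x /sn /andP[x0 xn].
  rewrite divr_ge0//=; last by rewrite natrM; lra.
  rewrite ler_pdivrMr; last by rewrite natrM; lra.
  rewrite natrM; have : `|w - x| <= 14 * N%:R by rewrite ler_norml /w; lra.
  lra.
Qed.

Lemma biv_shift_le N k (c : 'I_N -> 'I_N -> R) S t y :
  (forall a b, `|c a b| <= S) -> 0 <= S -> `|y| <= 1 -> 0 <= t <= 1 -> (1 <= k)%N ->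
  `|biv c (t - k%:R) y - biv c (- k%:R) y| <= S * (N%:R ^+ 3 * t * k%:R ^+ N).
Proof.
move=> cS S0 y1 /andP[t0 t1] k1; have k1' : 1 <= k%:R :> R by rewrite ler1n.
have -> : S * (N%:R ^+ 3 * t * k%:R ^+ N) =
    \sum_(a < N) \sum_(b < N) S * (N%:R * t * k%:R ^+ N).
  by rewrite !sum_const_ord; ring.
rewrite /biv -sumrB; apply: (le_trans (ler_norm_sum _ _ _)); apply: ler_sum => a _.
rewrite -sumrB; apply: (le_trans (ler_norm_sum _ _ _)); apply: ler_sum => b _.
rewrite -mulrBl -mulrBr normrM -[leRHS]mulr1; apply: ler_pM => //; last first.
  by rewrite normrX exprn_ile1.
rewrite normrM; apply: ler_pM => //.
apply: (le_trans (@dist_expr_le k%:R _ _ _ _ _ _)) => //.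
- by rewrite ler_norml; lra.
- by rewrite normrN ger0_norm.
- rewrite opprK subrK ger0_norm//; apply: ler_pM; rewrite ?mulr_ge0 ?exprn_ge0//.
    by rewrite ler_wpM2r// ler_nat ltnW.
  by rewrite ler_weXn2l// ltnW.
Qed.

Definition ordpoly N (e : 'I_N -> R) : {poly R} := \sum_(b < N) e b *: 'X^b.

Lemma horner_ordpoly N (e : 'I_N -> R) y : (ordpoly e).[y] = \sum_(b < N) e b * y ^+ b.
Proof. by rewrite horner_sum; apply: eq_bigr => b _; rewrite hornerZ hornerXn. Qed.

Lemma coef_ordpoly N (e : 'I_N -> R) (b : 'I_N) : (ordpoly e)`_b = e b.
Proof.
rewrite coef_sum (bigD1 b)//= coefZ coefXn eqxx mulr1 big1 ?addr0// => i ib.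
by rewrite coefZ coefXn eq_sym (negbTE ib : (i == b :> nat) = false) mulr0.
Qed.

Lemma size_ordpoly N (e : 'I_N -> R) : (size (ordpoly e) <= N)%N.
Proof.
apply: (leq_trans (size_sum _ _ _)); apply/bigmax_leqP => i _.
by rewrite (leq_trans (size_scale_leq _ _))// size_polyXn.
Qed.

(** Interpolation in the second variable, on the values of [1 / Gamma] at the
nodes near [- k]. *)
Lemma interp_rows N k (c : 'I_N -> 'I_N -> R) V : (0 < N)%N -> (4 * N < k)%N -> 0 <= V ->
  (forall l : 'I_N, `|biv c (- k%:R) (invGammaB k (node k l))| <= V) ->
  forall b, `|\sum_(a < N) c a b * (- k%:R) ^+ a| <= V * (33 * N%:R) ^+ N.
Proof.
move=> N0 kN V0 H b.
have N1 : 1 <= N%:R :> R by rewrite ler1n.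
pose q := ordpoly (fun b => \sum_(a < N) c a b * (- k%:R) ^+ a).
have qE y : q.[y] = biv c (- k%:R) y.
  rewrite horner_ordpoly /biv exchange_big/=; apply: eq_bigr => j _.
  by rewrite mulr_suml.
rewrite -[\sum_(a < N) _](coef_ordpoly (fun b => \sum_(a < N) c a b * (- k%:R) ^+ a)) -/q.
apply: (le_trans (nrm_coef _ _)).
pose s := [seq invGammaB k (node k l) | l <- enum 'I_N].
have g0 : 0 < (8 * N%:R)^-1 :> R by rewrite invr_gt0; lra.
have ss : size s = N by rewrite size_map size_enum_ord.
have gap := invGammaB_node_gap kN N0.
have inj : injective (fun l : 'I_N => invGammaB k (node k l)).
  move=> l m lm; apply/eqP; apply: contraT => lm'.
  by have := lt_le_trans g0 (gap _ _ lm'); rewrite lm subrr normr0 ltxx.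
have -> : 33 * N%:R = N%:R + 1 * 32 * N%:R :> R by lra.
apply: (@le_trans _ _ (V * (1 + 2 * (1 + 1) / (8 * N%:R)^-1) ^+ size s)).
  apply: nrm_interp => //.
  - by rewrite ss size_ordpoly.
  - by rewrite (map_inj_uniq inj) enum_uniq.
  - move=> x y /mapP[l _ ->] /mapP[m _ ->] h; apply: gap.
    by apply: contraNneq h => ->.
  - by move=> x /mapP[l _ ->]; exact: invGammaB_node_norm.
  - by move=> x /mapP[l _ ->]; rewrite qE.
rewrite ss ler_wpM2l// lerXn2r ?nnegrE ?invrK; lra.
Qed.

(** Interpolation in the first variable, on the integers [- k]. *)
Lemma interp_cols N (d : 'I_N -> R) V : (1 < N)%N -> 0 <= V ->
  (forall i : 'I_N, `|\sum_(a < N) d a * (- (12 * N + i)%:R) ^+ a| <= V) ->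
  forall a, `|d a| <= V * (29 * N%:R) ^+ N.
Proof.
move=> N2 V0 H a; have N2' : 2 <= N%:R :> R by rewrite ler_nat.
pose q := ordpoly d; have qE := horner_ordpoly d.
rewrite -(coef_ordpoly d) -/q.
apply: (le_trans (nrm_coef _ _)).
pose s := [seq (- (12 * N + nat_of_ord i)%:R : R) | i <- enum 'I_N].
have ss : size s = N by rewrite size_map size_enum_ord.
apply: (@le_trans _ _ (V * (1 + 2 * (1 + 13 * N%:R) / 1) ^+ size s)).
  apply: nrm_interp => //.
  - by rewrite ss size_ordpoly.
  - rewrite map_inj_uniq ?enum_uniq// => l m /oppr_inj/eqP.
    by rewrite eqr_nat eqn_add2l => /eqP/val_inj.
  - move=> x y /mapP[l _ ->] /mapP[m _ ->] h.
    rewrite opprK addrC; apply: natr_dist_ge1; rewrite eqn_add2l eq_sym.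
    by apply: contraNneq h => /val_inj ->.
  - move=> x /mapP[l _ ->]; rewrite normrN ger0_norm// -natrM ler_nat.
    by have := ltn_ord l; lia.
  - by move=> x /mapP[l _ ->]; rewrite qE.
rewrite ss divr1 ler_wpM2l// lerXn2r ?nnegrE; lra.
Qed.

(** With [S] the largest modulus of a coefficient, the values on the grid of
the pairs ([- k], value at a node), [12 * N <= k < 13 * N], are at most
[S * (e1 + e2)], where [e1] comes from the zeros and [e2] from replacing [t - k]
by [- k]. Interpolating twice recovers the coefficients at the cost of a factor
[N ^ (4 * N)], which both errors beat: the first one thanks to the number of
zeros, the second one because [k! >= N ^ (11 * N)]. Hence [S <= S / 2]. *)
Lemma zero_estimate N n (c : 'I_N -> 'I_N -> R) (s : seq R) :
  (64 <= N)%N -> (n <= N)%N ->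
  uniq s -> {in s, forall x, 0 < x <= n%:R} ->
  {in s, forall x, biv c x (Gamma x)^-1 = 0} ->
  (N ^ (1510 * N ^ 2) <= 3 ^ size s)%N ->
  forall a b, c a b = 0.
Proof.
move=> N64 nN us sn sz hM.
have N0 : (0 < N)%N by lia.
have NR : 64 <= N%:R :> R by rewrite ler_nat.
pose S := \big[Num.max/0]_(i : 'I_N * 'I_N) `|c i.1 i.2|.
have S0 : 0 <= S by apply: bigmax_ge_id.
have cS a b : `|c a b| <= S by apply: (le_bigmax _ (fun i : 'I_N * 'I_N => `|c i.1 i.2|) (a, b)).
pose e1 : R := N%:R ^+ 2 * (50 * N)%:R ^+ ((750 * N).+1 * N) / 3 ^+ size s.
pose e2 : R := N%:R ^+ 3 * (13 * N)%:R ^+ N / (12 * N)`!%:R.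
have e10 : 0 <= e1 by rewrite /e1 !mulr_ge0 ?exprn_ge0 ?invr_ge0 ?exprn_ge0.
have e20 : 0 <= e2 by rewrite /e2 !mulr_ge0 ?exprn_ge0 ?invr_ge0.
have rows k (l : 'I_N) : (12 * N <= k < 13 * N)%N ->
    `|biv c (- k%:R) (invGammaB k (node k l))| <= S * (e1 + e2).
  move=> kN; have /andP[k1 k2] := kN.
  have kN4 : (4 * N < k)%N by lia.
  have t0 : 0 < node k l :> R by exact: node_gt0.
  have kf : (0 : R) < k`!%:R by rewrite ltr0n fact_gt0.
  have tf : node k l <= k`!%:R^-1 :> R.
    rewrite -[leRHS]mul1r ler_pdivlMr// mulrC.
    by apply: (le_trans (fact_node_le k N0 l)); lra.
  have t1 : node k l <= 1 :> R.
    by apply: (le_trans tf); rewrite invf_le1// ler1n fact_gt0.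
  rewrite -[biv _ _ _](subKr (biv c (node k l - k%:R) (invGammaB k (node k l)))).
  apply: (le_trans (ler_normB _ _)); rewrite mulrDr; apply: lerD.
    exact: (biv_small l N0 nN).
  apply: (le_trans (biv_shift_le cS S0 _ _ _)).
  - exact: invGammaB_node_norm.
  - by rewrite ltW.
  - by apply: leq_ltn_trans kN4.
  - rewrite ler_wpM2l// /e2 mulrAC -[leLHS]mulrA -[leRHS]mulrA ler_wpM2l ?exprn_ge0//.
    apply: ler_pM; rewrite ?exprn_ge0 ?(ltW t0)//.
      by rewrite lerXn2r ?nnegrE// ler_nat ltnW.
    apply: (le_trans tf); rewrite lef_pV2 ?posrE ?ltr0n ?fact_gt0//.
    by rewrite ler_nat leq_fact.
have V0 : 0 <= S * (e1 + e2) by rewrite mulr_ge0// addr_ge0.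
have all_c a b : `|c a b| <= S * (e1 + e2) * (33 * N%:R) ^+ N * (29 * N%:R) ^+ N.
  apply: (@interp_cols N (fun a => c a b)); first by lia.
    by rewrite mulr_ge0// exprn_ge0// mulr_ge0.
  move=> i; apply: interp_rows => //; first by lia.
  by move=> l; apply: rows; have := ltn_ord i; lia.
pose Lam : R := (33 * N%:R) ^+ N * (29 * N%:R) ^+ N.
have Lam_le : Lam <= N%:R ^+ (4 * N).
  have -> : (4 * N = 2 * N + 2 * N)%N by lia.
  rewrite exprD !exprM; apply: ler_pM; rewrite ?exprn_ge0 ?mulr_ge0//.
    by rewrite lerXn2r ?nnegrE ?mulr_ge0 ?exprn_ge0// expr2 ler_wpM2r//; lra.
  by rewrite lerXn2r ?nnegrE ?mulr_ge0 ?exprn_ge0// expr2 ler_wpM2r//; lra.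
have small1 : e1 * N%:R ^+ (4 * N) <= 4^-1.
  have h := leq_trans (zeros_exponent N64) hM.
  rewrite /e1 mulrAC ler_pdivrMr ?exprn_gt0// -ler_pdivrMl ?invr_gt0// invrK.
  by move: h; rewrite -(ler_nat R) !natrM !natrX !natrM.
have small2 : e2 * N%:R ^+ (4 * N) <= 4^-1.
  have h := fact_exponent N64.
  rewrite /e2 mulrAC ler_pdivrMr ?ltr0n ?fact_gt0// -ler_pdivrMl ?invr_gt0// invrK.
  by move: h; rewrite -(ler_nat R) !natrM !natrX !natrM.
have S_half : S <= S / 2.
  apply/bigmax_leP; split; first by rewrite divr_ge0.
  move=> [a b] _ /=; apply: (le_trans (all_c a b)).
  rewrite -mulrA -/Lam -mulrA ler_wpM2l//.
  apply: (le_trans (ler_wpM2l (addr_ge0 e10 e20) Lam_le)); rewrite mulrDl; lra.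
have SE : S = 0.
  by apply/eqP; rewrite eq_le S0 andbT; move: S_half; clear; lra.
by move=> a b; apply/eqP; rewrite -normr_le0 -SE.
Qed.

End ZeroEstimate.

(** * Interpolation determinants *)

Section Counting.
Variable R : realType.

Lemma sum_ord_double Q : ((\sum_(i < Q) i) * 2 = Q * Q.-1)%N.
Proof.
elim: Q => [|Q IH]; first by rewrite big_ord0.
by rewrite big_ord_recr/= mulnDl IH; case: Q {IH} => //= Q; lia.
Qed.

Lemma leq_fact_exp Q : (Q`! <= Q ^ Q)%N.
Proof.
elim: Q => // Q IH; rewrite factS expnS leq_mul2l/=.
by apply: (leq_trans IH); case: Q {IH} => // Q; rewrite leq_exp2r.
Qed.

Lemma cvg_det Q (F : nat -> 'M[R]_Q) (A : 'M[R]_Q) :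
  (forall i j, F m i j @[m --> \oo] --> A i j) -> \det (F m) @[m --> \oo] --> \det A.
Proof.
move=> FA; apply: cvg_big; first exact: add_continuous.
move=> s _; apply: cvgMl_tmp; apply: cvg_big; first exact: mul_continuous.
by move=> i _.
Qed.

Lemma denq_pow_int (z : rat) a N : (a <= N)%N -> z ^+ a * (denq z)%:~R ^+ N \is a Num.int.
Proof.
move=> aN; rewrite -(subnK aN) exprD mulrCA -exprMn.
by rewrite -{2}[z]divq_num_den divfK ?intr_eq0 ?denq_eq0// rpredM ?rpredX ?intr_int.
Qed.

(** Liouville's inequality: after clearing denominators row by row the
determinant is a nonzero integer. *)
Lemma int_det_ge1 Q (A : 'M[rat]_Q) (h : 'I_Q -> rat) :
  (forall i j, A i j * h i \is a Num.int) -> (forall i, 0 <= h i) ->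
  \det A != 0 -> \prod_i h i != 0 -> 1 <= `|\det A| * \prod_i h i.
Proof.
move=> Ah h0 dA hn.
have dE : \det (diag_mx (\row_i h i) *m A) = \prod_i h i * \det A.
  by rewrite det_mulmx det_diag; congr (_ * _); apply: eq_bigr => i _; rewrite mxE.
have intd : \det (diag_mx (\row_i h i) *m A) \is a Num.int.
  apply: rpred_sum => s _; rewrite rpredM ?rpredX ?rpredN ?rpred1//.
  by apply: rpred_prod => i _; rewrite mul_diag_mx !mxE mulrC.
have p0 : 0 <= \prod_i h i by apply: prodr_ge0.
have := norm_intr_ge1 intd; rewrite dE mulf_neq0// => /(_ isT).
by rewrite normrM mulrC (ger0_norm p0).
Qed.

(** The rows of the interpolation matrix: all monomials of degree less than
[N] in each variable. *)
Definition monoms (S : comNzRingType) N (x y : S) : 'rV[S]_(N * N) :=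
  mxvec (\matrix_(a < N, b < N) (x ^+ a * y ^+ b)).

Lemma monomsE (S : comNzRingType) N (x y : S) a b :
  monoms N x y 0 (mxvec_index a b) = x ^+ a * y ^+ b.
Proof. by rewrite mxvecE mxE. Qed.

Lemma monoms_dot (S : comNzRingType) N (x y : S) (v : 'rV[S]_(N * N)) :
  \sum_j v 0 j * monoms N x y 0 j =
  \sum_(a < N) \sum_(b < N) v 0 (mxvec_index a b) * x ^+ a * y ^+ b.
Proof.
rewrite pair_bigA (reindex _ (curry_mxvec_bij N N)); apply: eq_bigr => -[a b] _ /=.
by rewrite monomsE mulrA.
Qed.

(** Upper against lower bound for the determinant. With [N = 80 * r], the
exponent of [r] is of size [N ^ 4] on the right, and on the left it is
[18 / 20] of that: this is where the [80] comes from. *)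
Lemma det_bounds_clash r N Q rho H : (80 <= r)%N -> N = (80 * r)%N -> Q = (N ^ 2)%N ->
  (r <= rho ^ 2)%N -> (H <= r ^ (3 * r * N))%N ->
  (Q`! * (r ^ ((15 * r).+1 * N)) ^ Q * H ^ Q < rho ^ (\sum_(i < Q) i))%N.
Proof.
move=> r80 NE QE rr HH.
have Q0 : (0 < Q)%N by rewrite QE expn_gt0 NE muln_gt0; lia.
(* Fourth powers clear the halves: one from [r <= rho ^ 2], one from the sum of
   the exponents. *)
rewrite -(@ltn_exp2r _ _ 4)// -(expnM rho).
have -> : ((\sum_(i < Q) i) * 4 = 2 * (Q * Q.-1))%N.
  by rewrite -sum_ord_double; lia.
rewrite (expnM rho); apply: (@leq_trans (r ^ (Q * Q.-1))); last first.
  by rewrite leq_exp2r// muln_gt0 Q0/=; rewrite QE NE; nia.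
have Qr : (Q <= r ^ 4)%N.
  apply: (@leq_trans (r ^ 2 * r ^ 2)%N); last by rewrite -expnD.
  by rewrite QE NE expnMn leq_mul2r leq_exp2r// r80 orbT.
have h1 : (Q`! * (r ^ ((15 * r).+1 * N)) ^ Q * H ^ Q <=
    (r ^ 4 * r ^ ((15 * r).+1 * N) * r ^ (3 * r * N)) ^ Q)%N.
  rewrite 2!expnMn; apply: leq_mul; last by rewrite leq_exp2r.
  by apply: leq_mul => //; apply: (leq_trans (leq_fact_exp Q)); rewrite leq_exp2r.
apply: (@leq_ltn_trans (((r ^ 4 * r ^ ((15 * r).+1 * N) * r ^ (3 * r * N)) ^ Q) ^ 4)%N).
  by rewrite leq_exp2r.
rewrite -!expnD -!expnM ltn_exp2l; last by apply: leq_trans r80.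
rewrite -mulnA (mulnC Q 4) mulnA [X in (_ < X)%N]mulnC ltn_pmul2r//.
have e1 : (N ^ 2 = 80 * (r * N))%N by rewrite -mulnn {1}NE mulnA.
have e2 : (80 * N <= r * N)%N by rewrite leq_mul2r r80 orbT.
have e3 : (0 < N)%N by rewrite NE muln_gt0 (leq_trans _ r80).
rewrite QE e1 mulSn -!mulnA; move: e2 e3; clear; set p := (r * N)%N; lia.
Qed.

(** [det_interp_le] passed to the limit along the approximants of
[1 / Gamma]. *)
Lemma det_monoms_le Q N r n (eQ : Q = (N * N)%N) (z : 'I_Q -> R) :
  (4 <= r)%N -> (n < r)%N -> (forall i, 0 < z i <= n%:R) ->
  (forall i j, `|z i - z j| <= 1) ->
  `|\det (\matrix_(i < Q, j < Q) monoms N (z i) (Gamma (z i))^-1 0 (cast_ord eQ j))| <=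
  Q`!%:R * \prod_(i < Q) ((r ^ ((15 * r).+1 * N))%:R / (r - n)%:R ^+ i).
Proof.
move=> r4 nr zn z1.
have r1 : 1 <= r%:R :> R by rewrite ler1n (leq_trans _ r4).
have r0 : 0 <= r%:R :> R by [].
have [p [pn pS]] := approx_seq [seq z i | i <- enum 'I_Q].
pose P m (j : 'I_Q) : {poly R} := monoms N 'X (p m) 0 (cast_ord eQ j).
have PE m j x : (P m j).[x] = monoms N x (p m).[x] 0 (cast_ord eQ j).
  rewrite /P; case: (mxvec_indexP (cast_ord eQ j)) => a b.
  by rewrite !monomsE hornerM hornerXn horner_exp.
have nP m j : nrm r%:R (P m j) <= (r ^ ((15 * r).+1 * N))%:R.
  rewrite /P; case: (mxvec_indexP (cast_ord eQ j)) => a b.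
  rewrite monomsE mulrC nrmMXn.
  have -> : ((15 * r).+1 * N = N + (15 * r) * N)%N by lia.
  rewrite natrX exprD; apply: ler_pM; rewrite ?exprn_ge0 ?nrm_ge0//.
    by rewrite ler_weXn2l// ltnW.
  apply: (le_trans (nrmX _ _ r0)); rewrite exprM.
  apply: (@le_trans _ _ ((r%:R ^+ (15 * r)) ^+ b)).
    by rewrite lerXn2r ?nnegrE ?nrm_ge0 ?exprn_ge0// pn.
  by rewrite ler_weXn2l ?exprn_ege1// ltnW.
have cv : \det (\matrix_(i, j) (P m j).[z i]) @[m --> \oo] -->
    \det (\matrix_(i < Q, j < Q) monoms N (z i) (Gamma (z i))^-1 0 (cast_ord eQ j)).
  apply: (@cvg_det Q (fun m => \matrix_(i, j) (P m j).[z i])) => i j; rewrite mxE.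
  rewrite (_ : (fun m => _) = (fun m => monoms N (z i) (p m).[z i] 0 (cast_ord eQ j))); last first.
    by apply/funext => m; rewrite mxE PE.
  case: (mxvec_indexP (cast_ord eQ j)) => a b; rewrite monomsE.
  rewrite (_ : (fun m => _) = (fun m => z i ^+ a * (p m).[z i] ^+ b)); last first.
    by apply/funext => m; rewrite monomsE.
  apply: cvgMl_tmp; apply: cvg_exprn; apply: pS.
    by apply: map_f; rewrite mem_enum.
  by apply: gaussf_cvg; case/andP: (zn i).
apply: (cvgr_to_le (cvg_norm cv)); apply: nearW => m.
have := @det_interp_le R Q r%:R n%:R (r ^ ((15 * r).+1 * N))%:R z (P m).
rewrite natrB 1?ltnW//; apply => //.
- by move=> i; have /andP[z0 zi] := zn i; rewrite ger0_norm// ltW.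
- by rewrite ltr_nat.
Qed.

(** A linear relation between the columns is a bivariate polynomial vanishing
at all points ([z], [1 / Gamma z]), which [zero_estimate] excludes. *)
Lemma rank_monoms M N n (z y : 'I_M -> rat) : (64 <= N)%N -> (n <= N)%N ->
  injective z -> (forall i, 0 < z i <= n%:R) ->
  (forall i, (Gamma (ratr (z i) : R))^-1 = ratr (y i)) ->
  (N ^ (1510 * N ^ 2) <= 3 ^ M)%N ->
  row_full (\matrix_(i < M) monoms N (z i) (y i)).
Proof.
move=> N64 nN zinj zn zy hM; set X := \matrix_i _.
rewrite /row_full -mxrank_tr -[_ == _]/(row_free X^T).
apply: inj_row_free => v vX.
pose c (a b : 'I_N) : R := ratr (v 0 (mxvec_index a b)).
have c0 : forall a b, c a b = 0.
  apply: (@zero_estimate R N n c [seq ratr (z i) | i <- enum 'I_M]) => //.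
  - by rewrite map_inj_uniq ?enum_uniq// => i j /fmorph_inj/zinj.
  - move=> x /mapP[i _ ->]; have /andP[z0 zi] := zn i.
    by rewrite ltr0q z0/= -(ratr_nat R) ler_rat.
  - move=> x /mapP[i _ ->]; rewrite zy.
    transitivity (ratr (\sum_j v 0 j * monoms N (z i) (y i) 0 j) : R).
      rewrite monoms_dot /biv rmorph_sum; apply: eq_bigr => a _.
      rewrite rmorph_sum; apply: eq_bigr => b _.
      by rewrite !rmorphM !rmorphXn.
    have := congr1 (fun w : 'rV_M => w 0 i) vX; rewrite !mxE.
    move=> e; rewrite [X in ratr X](_ : _ = 0) ?rmorph0// -[RHS]e.
    by apply: eq_bigr => j _; rewrite !mxE.
  - by rewrite size_map size_enum_ord.
apply/rowP => j; rewrite mxE; case: (mxvec_indexP j) => a b.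
by apply: (fmorph_inj (ratr : {rmorphism rat -> R})); rewrite rmorph0; exact: c0.
Qed.

(** If there were more points, the interpolation matrix would have full rank;
some maximal minor would then be nonzero, and its two bounds clash. *)
Lemma count_bound r n D M (z y : 'I_M -> rat) : (80 <= r)%N -> (2 * n <= r)%N ->
  (0 < n)%N -> (0 < D)%N -> (D <= r ^ r)%N -> injective z ->
  (forall i, n%:R - 1 <= z i <= n%:R) -> (forall i, 0 < z i) ->
  (forall i, denq (z i) <= D%:Z) ->
  (forall i, (Gamma (ratr (z i) : R))^-1 = ratr (y i)) ->
  (forall i, denq (y i) <= (D * n ^ n)%N%:Z) ->
  (3 ^ M < (80 * r) ^ (1510 * (80 * r) ^ 2))%N.
Proof.
move=> r80 nr n0 D0 Dr zinj zn z0 zD zy yD; rewrite ltnNge; apply/negP => hM.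
pose N := (80 * r)%N; pose Q := (N * N)%N.
have zn' i : 0 < z i <= n%:R by rewrite z0/=; case/andP: (zn i).
have full : row_full (\matrix_(i < M) monoms N (z i) (y i)).
  by apply: (rank_monoms _ _ zinj zn' zy hM); rewrite /N; lia.
pose f := fullrankfun full.
have := fullrowsub_unit full; set A := rowsub _ _.
rewrite unitmxE unitfE => dA.
have AE i j : A i j = monoms N (z (f i)) (y (f i)) 0 j by rewrite !mxE.
pose h i : rat := (denq (z (f i)) * denq (y (f i)))%:~R ^+ N.
have h0 i : 0 < h i by rewrite exprn_gt0// ltr0z mulr_gt0 ?denq_gt0.
have lower : 1 <= `|\det A| * \prod_i h i.
  apply: int_det_ge1 => //.
  - move=> i j; rewrite AE /h; case: (mxvec_indexP j) => a b.
    rewrite monomsE intrM exprMn mulrACA.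
    by rewrite rpredM ?denq_pow_int// ltnW.
  - by move=> i; exact: ltW.
  - by rewrite gt_eqF// prodr_gt0.
pose H := ((D * (D * n ^ n)) ^ N)%N.
have hH i : h i <= H%:R.
  rewrite /h /H natrX lerXn2r ?nnegrE ?ler0z ?mulr_ge0 ?(ltW (denq_gt0 _))//.
  rewrite [leRHS]pmulrn ler_int PoszM; apply: ler_pM => //; exact: ltW (denq_gt0 _).
have upper := @det_monoms_le Q N r n erefl (fun i => ratr (z (f i)))
  (leq_trans (isT : 4 <= 80)%N r80).
have nr' : (n < r)%N by lia.
have {}upper := upper nr'.
have upper2 : `|ratr (\det A) : R| <=
    Q`!%:R * \prod_(i < Q) ((r ^ ((15 * r).+1 * N))%:R / (r - n)%:R ^+ i).
  rewrite -det_map_mx; apply: le_trans (upper _ _).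
  - rewrite le_eqVlt; apply/orP; left; apply/eqP; congr (`|\det _|).
    apply/matrixP => i j; rewrite mxE AE mxE cast_ord_id zy.
    by case: (mxvec_indexP j) => a b; rewrite !monomsE rmorphM !rmorphXn.
  - move=> i; have /andP[zi1 zi2] := zn' (f i).
    by rewrite ltr0q zi1/= -(ratr_nat R) ler_rat.
  - move=> i j; rewrite -rmorphB -ratr_norm -[X in _ <= X](rmorph1 ratr) ler_rat.
    have /andP[a1 a2] := zn (f i); have /andP[b1 b2] := zn (f j).
    by rewrite ler_norml; lra.
have : 1 <= `|ratr (\det A) : R| * H%:R ^+ Q.
  rewrite -ratr_norm -(ratr_nat R) -rmorphXn -rmorphM -[X in X <= _](rmorph1 ratr) ler_rat.
  apply: (le_trans lower); rewrite ler_wpM2l//.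
  rewrite -[Q]card_ord -prodr_const; apply: ler_prod => i _.
  by rewrite (ltW (h0 i))/= hH.
apply/negP; rewrite -ltNge.
apply: (le_lt_trans (ler_wpM2r _ upper2)); first by rewrite exprn_ge0.
have rho0 : (0 : R) < (r - n)%:R by rewrite ltr0n subn_gt0.
rewrite prodf_div prodr_const card_ord -expr_sum mulrA mulrAC ltr_pdivrMr ?exprn_gt0// mul1r.
rewrite -!natrX -!natrM ltr_nat.
apply: (det_bounds_clash r80 (erefl N)); first by rewrite /Q mulnn.
  by rewrite -mulnn (@leq_trans ((r - n) * 2))//; [lia|rewrite leq_mul2l; lia].
rewrite /H (expnM r (3 * r) N) leq_exp2r; last by rewrite /N muln_gt0 (leq_trans _ r80).
have -> : (3 * r = r + (r + r))%N by lia.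
rewrite !expnD; apply: leq_mul => //; apply: leq_mul => //.
have nr2 : (n <= r)%N by lia.
apply: (@leq_trans (n ^ r)); first by rewrite leq_pexp2l.
by rewrite leq_exp2r// (leq_trans _ r80).
Qed.

End Counting.

(** * Counting *)

Section Final.
Variable R : realType.

(** [e <= (1 - 1 / 6) ^ (- 6)]. This makes [ln (ln D)] positive for
[D >= 3]. *)
Lemma expR1_lt3 : expR 1 < (3 : R).
Proof.
have h : expR 6^-1 <= (6 / 5 : R).
  rewrite -[leLHS]invrK -expRN -[leRHS]invrK lef_pV2 ?posrE ?expR_gt0 ?invr_gt0//.
  have := expR_ge1Dx (- 6^-1 : R); lra.
have -> : 1 = 6%:R * 6^-1 :> R by rewrite mulfV.
rewrite expRM_natl; apply: (@le_lt_trans _ _ ((6 / 5) ^+ 6)).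
  by rewrite lerXn2r ?nnegrE ?expR_ge0//; lra.
lra.
Qed.

Lemma ln3_gt1 : 1 < ln (3 : R).
Proof. by rewrite -ltr_expR lnK ?posrE//; exact: expR1_lt3. Qed.

Lemma ln2_ge_half : 2^-1 <= ln (2 : R).
Proof.
rewrite -ler_expR lnK ?posrE//.
rewrite -[leLHS]invrK -expRN -[leRHS]invrK lef_pV2 ?posrE ?expR_gt0 ?invr_gt0//.
have := expR_ge1Dx (- 2^-1 : R); lra.
Qed.

Lemma ln_le_div_sub1 (a x : R) : 0 < a -> 0 < x -> ln x <= ln a + x / a - 1.
Proof.
move=> a0 x0; have := @le_ln1Dx R (x / a - 1).
rewrite (addrC 1) subrK ln_div ?posrE// => h.
have {}h : ln x - ln a <= x / a - 1.
  by apply: h; rewrite ltrBDr addrC subrr divr_gt0.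
lra.
Qed.

Lemma lnX_natl (x : R) k : 0 < x -> ln (x ^+ k) = k%:R * ln x.
Proof. by move=> x0; rewrite lnXn// mulr_natl. Qed.

(** The right-hand side is the numerator of [w]. *)
Lemma denqV (w : rat) : 0 < w -> (denq w^-1)%:~R = w * (denq w)%:~R :> rat.
Proof.
move=> w0; have n0 : numq w != 0 by rewrite numq_eq0 gt_eqF.
have -> : w^-1 = (denq w)%:~R / (numq w)%:~R.
  by rewrite -[in LHS](divq_num_den w) invf_div.
rewrite coprimeq_den; last by rewrite coprime_sym coprime_num_den.
by rewrite (negbTE n0) gtr0_norm ?numq_gt0// numqE.
Qed.

(** [count_bound] in logarithmic form, with [80 * r <= r ^ 2] and
[1 <= ln 3]. *)
Lemma ln_expn_bound M (r : nat) : (80 <= r)%N ->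
  (3 ^ M < (80 * r) ^ (1510 * (80 * r) ^ 2))%N ->
  M%:R <= (1510 * 80 ^+ 2 * 2) * (r%:R ^+ 2 * ln r%:R) :> R.
Proof.
move=> r80 h; have r0 : (0 < r)%N by apply: leq_trans r80.
have r0' : 0 < r%:R :> R by rewrite ltr0n.
have r80' : 80 <= r%:R :> R by rewrite (ler_nat R 80).
have lnr : 0 <= ln r%:R :> R by rewrite ln_ge0// ler1n.
have := h; rewrite -(ltr_nat R) !natrX -ltr_ln ?posrE ?exprn_gt0 ?ltr0n ?muln_gt0//.
rewrite !lnX_natl ?ltr0n ?muln_gt0// [(80 * r)%:R]natrM lnM ?posrE// => hl.
have l3 := ln3_gt1.
have l80 : ln 80 <= ln r%:R :> R by rewrite ler_ln ?posrE//; lra.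
apply: (@le_trans _ _ (M%:R * ln 3)); first by rewrite ler_peMr// ltW.
apply: (le_trans (ltW hl)).
rewrite natrM natrX natrM.
set a : R := 1510%:R; have a0 : 0 <= a by rewrite ler0n.
set b : R := 80%:R; set l := ln r%:R; set x := r%:R.
apply: (@le_trans _ _ (a * (b * x) ^+ 2 * (l + l))).
  by rewrite ler_wpM2l ?mulr_ge0 ?exprn_ge0 ?mulr_ge0 ?(ltW r0')// lerD2r.
by rewrite le_eqVlt; apply/orP; left; apply/eqP; ring.
Qed.

Lemma count_bound_seq r n D (zs : seq rat) : (80 <= r)%N -> (2 * n <= r)%N ->
  (2 <= n)%N -> (0 < D)%N -> (D <= r ^ r)%N -> uniq zs ->
  {in zs, forall z, n%:R - 1 <= z <= n%:R} ->
  {in zs, forall z, denq z <= D%:Z} ->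
  {in zs, forall z, exists2 y : rat, (Gamma (ratr z : R))^-1 = ratr y &
     denq y <= (D * n ^ n)%N%:Z} ->
  (3 ^ size zs < (80 * r) ^ (1510 * (80 * r) ^ 2))%N.
Proof.
move=> r80 nr n2 D0 Dr us zn zD zy.
pose z (i : 'I_(size zs)) := nth 0 zs i.
have zin i : z i \in zs by apply: mem_nth.
have [y yP] : {y : 'I_(size zs) -> rat & forall i,
    (Gamma (ratr (z i) : R))^-1 = ratr (y i) /\ denq (y i) <= (D * n ^ n)%N%:Z}.
  apply: (@choice _ _ (fun i y => (Gamma (ratr (z i) : R))^-1 = ratr y /\
    denq y <= (D * n ^ n)%N%:Z)) => i.
  by have [y y1 y2] := zy _ (zin i); exists y.
have n2' : 2 <= n%:R :> rat by rewrite ler_nat.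
apply: (@count_bound R r n D (size zs) z y) => //.
- by apply: leq_trans n2.
- move=> i j /eqP; rewrite /z nth_uniq// => /eqP h; exact: val_inj.
- by move=> i; apply: zn.
- by move=> i; have /andP[+ _] := zn _ (zin i); lra.
- by move=> i; apply: zD.
- by move=> i; have [] := yP i.
- by move=> i; have [] := yP i.
Qed.

(** The radius must satisfy [ln D <= r * ln r], so that denominators and
growth balance; [2 * ln D / ln (ln D)] is large enough, because its logarithm is
at least [ln (ln D) / 2]. *)
Lemma radius (n D : nat) : (2 <= n)%N -> (3 <= D)%N ->
  let L := ln D%:R : R in let Q := L / ln L in
  exists r : nat, [/\ (80 <= r)%N, (2 * n <= r)%N, (D <= r ^ r)%N & r%:R <= 44 * n%:R * Q].
Proof.
move=> n2 D3 L Q.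
have L1 : 1 < L.
  by apply: (lt_le_trans ln3_gt1); rewrite ler_ln ?posrE ?ltr0n ?(ltn_trans _ D3)// (ler_nat R 3).
have l0 : 0 < ln L by rewrite ln_gt0.
have Q1 : 1 <= Q by rewrite ler_pdivlMr// mul1r ltW// ln_sublinear; lra.
have n2' : 2 <= n%:R :> R by rewrite ler_nat.
pose r := (80 + 2 * n + (Num.truncn (2 * Q)).+1)%N.
have r1 : 2 * Q <= r%:R.
  rewrite /r natrD; apply: (le_trans (ltW (truncnS_gt _))).
  by rewrite lerDr.
exists r; split.
- by rewrite /r -addnA leq_addr.
- by rewrite /r (addnC 80%N) -addnA leq_addr.
- have r0 : 0 < r%:R :> R by lra.
  have h : L <= r%:R * ln r%:R.
    have lr : ln L / 2 <= ln r%:R.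
      apply: (@le_trans _ _ (ln (2 * Q))); last by rewrite ler_ln ?posrE//; lra.
      rewrite lnM ?posrE//; last lra.
      rewrite /Q ln_div ?posrE//; last lra.
      have := @ln_le_div_sub1 2 (ln L) (ltr0n _ _) l0; lra.
    have -> : L = (2 * Q) * (ln L / 2) by rewrite /Q; field; rewrite gt_eqF.
    by apply: ler_pM => //; [lra|rewrite divr_ge0// ltW].
  rewrite -(ler_nat R) natrX -ler_ln ?posrE ?exprn_gt0 ?ltr0n//; last by rewrite (ltn_trans _ D3).
  by rewrite lnX_natl.
- rewrite /r (natrD _ (80 + 2 * n)) (natrD _ 80) natrM -natr1.
  have Q0 : 0 <= 2 * Q by lra.
  have := truncn_le (2 * Q); rewrite Q0 => t; set T := (Num.truncn _)%:R in t *.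
  have nQ : n%:R <= n%:R * Q by rewrite ler_peMr//; lra.
  have Qn : 2 * Q <= n%:R * Q by rewrite ler_wpM2r//; lra.
  have : 80%:R = 80 :> R by [].
  lra.
Qed.

Lemma absorb_constants (k l m : R) : 0 < k -> k <= l -> 2^-1 <= m ->
  44 + m + (l + k^-1) <= (88 / k + k^-1 + 2 + 2 / k ^+ 2) * (m * l).
Proof.
move=> k0 kl m2; have l0 : 0 < l by apply: lt_le_trans kl.
have i1 : 1 <= l / k by rewrite ler_pdivlMr// mul1r.
have i2 : 1 <= 2 * (m * (l / k)).
  have : 1 * 1 <= (2 * m) * (l / k) by apply: ler_pM => //; lra.
  by rewrite mul1r -mulrA.
have e1 : 44 <= 44 * (2 * (m * (l / k))) by rewrite ler_peMr.
have e2 : m <= m * (l / k) by rewrite ler_peMr//; lra.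
have e3 : l <= 2 * (m * l) by rewrite mulrA ler_peMl ?(ltW l0)//; lra.
have e4 : k^-1 <= k^-1 * (2 * (m * (l / k))).
  by rewrite ler_peMr ?invr_ge0 ?(ltW k0).
rewrite (_ : _ * (m * l) = 44 * (2 * (m * (l / k))) + m * (l / k) +
  (2 * (m * l) + k^-1 * (2 * (m * (l / k))))); last by field; rewrite gt_eqF.
by apply: lerD; apply: lerD.
Qed.

(** With [r] of size [n * Q], [Q = ln D / ln (ln D)], the count is
[O(r ^ 2 * ln r)], and [ln r] is [O(ln n * ln (ln D))] because both logarithms
are bounded below by positive constants. *)
Lemma count_real : exists2 c : R, 0 < c & forall (n D : nat) (zs : seq rat),
  (2 <= n)%N -> (3 <= D)%N -> uniq zs ->
  {in zs, forall z, n%:R - 1 <= z <= n%:R} ->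
  {in zs, forall z, denq z <= D%:Z} ->
  {in zs, forall z, exists2 y : rat, (Gamma (ratr z : R))^-1 = ratr y &
     denq y <= (D * n ^ n)%N%:Z} ->
  (size zs)%:R <= c * n%:R ^+ 2 * ln n%:R ^+ 3 * (ln D%:R ^+ 2 / ln (ln D%:R)).
Proof.
pose k : R := ln (ln 3).
have k0 : 0 < k by rewrite ln_gt0// ln3_gt1.
have [c1 c10 c1E] : exists2 c1 : R, 0 < c1 & c1 = 88 / k + k^-1 + 2 + 2 / k ^+ 2.
  by eexists; last reflexivity; rewrite !addr_gt0 ?divr_gt0 ?invr_gt0 ?exprn_gt0.
have pos j : (0 < j)%N -> 0 < j%:R :> R by rewrite ltr0n.
have [K K0 KE] : exists2 K : R, 0 < K & K = 1510 * 80 ^+ 2 * 2.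
  eexists; last reflexivity.
  exact: (mulr_gt0 (mulr_gt0 (pos 1510 isT) (exprn_gt0 2 (pos 80 isT))) (pos 2 isT)).
have C0 : 0 < K * 44 ^+ 2 * c1 * 4.
  exact: (mulr_gt0 (mulr_gt0 (mulr_gt0 K0 (exprn_gt0 2 (pos 44 isT))) c10) (pos 4 isT)).
exists (K * 44 ^+ 2 * c1 * 4); first exact: C0.
move=> n D zs n2 D3 us zn zD zy.
set L := ln D%:R : R; pose Q := L / ln L.
have [r [r80 nr Dr rQ]] := @radius n D n2 D3; rewrite -/L -/Q in rQ.
have D0 : (0 < D)%N by apply: leq_trans D3.
have := ln_expn_bound r80 (count_bound_seq r80 nr n2 D0 Dr us zn zD zy).
rewrite -KE => {KE} h; apply: (le_trans h) => {h}.
have L3 : ln 3 <= L.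
  by rewrite ler_ln ?posrE ?ltr0n// (ler_nat R 3).
have l3 := ln3_gt1.
have L0 : 0 < L by lra.
have kl : k <= ln L by rewrite /k ler_ln ?posrE//; lra.
set l := ln L in kl *; have l0 : 0 < l by lra.
have n2' : 2 <= n%:R :> R by rewrite ler_nat.
have ln2 : 2^-1 <= ln n%:R :> R.
  by apply: (le_trans ln2_ge_half); rewrite ler_ln ?posrE//; lra.
set m := ln n%:R in ln2 *.
have r0 : 0 < r%:R :> R by rewrite ltr0n (leq_trans _ r80).
have Q0 : 0 < Q by rewrite divr_gt0.
have n0 : 0 < n%:R :> R by lra.
have p44 := mulr_gt0 (pos 44 isT) n0; have p44Q := mulr_gt0 p44 Q0.
have lr : ln r%:R <= c1 * (m * l).
  apply: (@le_trans _ _ (ln (44 * n%:R * Q))).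
    by rewrite ler_ln ?posrE.
  rewrite lnM ?posrE// lnM ?posrE// -/m /Q ln_div ?posrE// -/l.
  have h1 : ln 44 <= 44 :> R by rewrite ltW// ln_sublinear.
  have h2 : - ln l <= k^-1.
    rewrite -lnV ?posrE//; apply: (@le_trans _ _ l^-1).
      by rewrite ltW// ln_sublinear// invr_gt0.
    by rewrite lef_pV2 ?posrE.
  rewrite c1E; apply: (le_trans _ (absorb_constants k0 kl ln2)).
  by apply: lerD; [rewrite lerD2r|rewrite lerD2l].
have r2 : r%:R ^+ 2 <= (44 * n%:R * Q) ^+ 2.
  by rewrite lerXn2r ?nnegrE ?(ltW p44Q) ?(ltW r0).
have lr0 : 0 <= ln r%:R :> R by rewrite ln_ge0// ler1n (leq_trans _ r80).
have main : r%:R ^+ 2 * ln r%:R <= (44 * n%:R * Q) ^+ 2 * (c1 * (m * l)).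
  by apply: ler_pM => //; rewrite exprn_ge0// ltW.
apply: (le_trans (ler_wpM2l (ltW K0) main)).
have m4 : 1 <= 4 * m ^+ 2 by move: ln2; clear; nra.
have -> : K * 44 ^+ 2 * c1 * 4 * n%:R ^+ 2 * m ^+ 3 * (L ^+ 2 / l) =
  K * ((44 * n%:R * Q) ^+ 2 * (c1 * (m * l))) * (4 * m ^+ 2).
  by rewrite /Q -/l; field; rewrite gt_eqF.
have m0 : 0 <= m by apply: le_trans ln2; rewrite invr_ge0.
have X0 := mulr_ge0 (ltW K0) (mulr_ge0 (exprn_ge0 2 (ltW p44Q))
  (mulr_ge0 (ltW c10) (mulr_ge0 m0 (ltW l0)))).
by rewrite ler_peMr.
Qed.

End Final.

Theorem mainTheorem1 (R : realType) :
  (exists2 c : R, 0 < c & forall n D : nat, (2 <= n)%N -> (3 <= D)%N ->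
     (num_rational_points (fun x : R => Gamma x) D n)%:R <=
       c * n%:R ^+ 4 * ln n%:R ^+ 3 * (ln D%:R ^+ 2 / ln (ln D%:R)))
  /\
  (exists2 c' : R, 0 < c' & forall n D : nat, (2 <= n)%N -> (3 <= D)%N ->
     (num_rational_points (fun x : R => 1 / Gamma x) D n)%:R <=
       c' * n%:R ^+ 2 * ln n%:R ^+ 3 * (ln D%:R ^+ 2 / ln (ln D%:R))).
Proof.
have [c c0 cP] := count_real R.
have mem (f : R -> R) D n : (0 < n)%N ->
    {in fset_set (rational_points f D n), forall z, rational_points f D n z}.
  move=> n0 z; rewrite in_fset_set; last exact: finite_rational_points.
  by rewrite inE.
split; exists c => // n D n2 D3.
(* The value [1 / Gamma z] is [w^-1]; its denominator is the numerator of [w],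
   at most [D * n ^ n]. *)
- have n0 : (0 < n)%N by apply: leq_trans n2.
  apply: (@le_trans _ _ (c * n%:R ^+ 2 * ln n%:R ^+ 3 * (ln D%:R ^+ 2 / ln (ln D%:R)))).
    apply: cP => //; first exact: fset_uniq.
    + by move=> z /mem-/(_ n0)[].
    + by move=> z /mem-/(_ n0)[].
    + move=> z /mem-/(_ n0)[/andP[z1 z2] zD [w wD wE]].
      have z1' : 1 <= z.
        by apply: le_trans z1; rewrite lerBrDr -(natrD _ 1 1) ler_nat.
      have zR : 1 <= (ratr z : R) <= n%:R.
        by rewrite -[X in X <= _ <= _](rmorph1 ratr) -(ratr_nat R n) !ler_rat z1'.
      have w0 : 0 < w.
        by rewrite -(ltr0q R) -wE Gamma_gt0//; case/andP: zR; lra.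
      have wn : w <= (n ^ n)%:R.
        by rewrite -(ler_rat R) -wE ratr_nat natrX; exact: Gamma_le_expn.
      exists w^-1; first by rewrite wE fmorphV.
      rewrite -(ler_int rat) denqV// PoszM intrM mulrC.
      apply: ler_pM; rewrite ?ler0z ?denq_ge0 ?(ltW w0)//.
      by rewrite ler_int.
  have L1 : 1 <= ln D%:R :> R.
    rewrite (le_trans (ltW (ln3_gt1 R)))// ler_ln ?posrE ?ltr0n// ?(ler_nat R 3)//.
    exact: leq_trans D3.
  have W0 : 0 <= ln D%:R ^+ 2 / ln (ln D%:R) :> R.
    by rewrite divr_ge0 ?exprn_ge0 ?(le_trans ler01 L1)// ln_ge0.
  have m0 : 0 <= ln n%:R ^+ 3 :> R by rewrite exprn_ge0// ln_ge0// ler1n.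
  rewrite ler_wpM2r// ler_wpM2r// ler_wpM2l ?(ltW c0)//.
  by rewrite ler_weXn2l// ler1n.
- have n0 : (0 < n)%N by apply: leq_trans n2.
  apply: cP => //; first exact: fset_uniq.
  + by move=> z /mem-/(_ n0)[].
  + by move=> z /mem-/(_ n0)[].
  + move=> z /mem-/(_ n0)[_ _ [w wD wE]]; exists w; first by rewrite -wE div1r.
    apply: (le_trans wD); rewrite lez_nat leq_pmulr// expn_gt0 n0//.
Qed.
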